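(* Let $n\ge 1$ and $0\le k\le \lfloor n/2\rfloor$. The $(n-k,k)$ Springer variety $\mathcal{S}_{n-k,k}$ is diffeomorphic to the space $X_{n-k,k}\subset (S^2)^n$.
   Context: A complete flag in $\mathbb{C}^n$ is a chain of subspaces $V_1\subset V_2\subset\cdots\subset V_n=\mathbb{C}^n$ with $\dim_{\mathbb{C}} V_i=i$. Let $\Gamma:\mathbb{C}^n\to\mathbb{C}^n$ be a nilpotent linear operator with Jordan blocks of sizes $n-k$ and $k$. The $(n-k,k)$ Springer variety is $\mathcal{S}_{n-k,k}=\{V_\bullet \text{ a complete flag in }\mathbb{C}^n:\ \Gamma V_i\subseteq V_i\text{ for all }i\}$. A noncrossing matching of type $(n-k,k)$ is a nonintersecting arrangement, in the upper half plane, of $k$ arcs and $n-2k$ infinite vertical rays incident on $n$ vertices $1,\dots,n$ placed from left to right on a horizontal line, each vertex being an endpoint of exactly one arc or ray; arcs may not cross arcs or rays (so no ray starts strictly between the endpoints of an arc). $B^{n-k,k}$ is the set of all such matchings. Write $(i,j)\in{\bf a}$ ($i<j$) if ${\bf a}$ has an arc joining $i$ and $j$, and $(i)\in{\bf a}$ if ${\bf a}$ has a ray at $i$. Let $p=(0,0,1)$ be the north pole of the unit sphere $S^2\subset\mathbb{R}^3$, and let $-p$ be its antipode. For ${\bf a}\in B^{n-k,k}$ put $$S_{{\bf a}}=\{(x_1,\dots,x_n)\in (S^2)^n:\ x_i=x_j\text{ if }(i,j)\in{\bf a},\ \ x_i=(-1)^ip\text{ if }(i)\in{\bf a}\},\qquad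 X_{n-k,k}=\bigcup_{{\bf a}\in B^{n-k,k}}S_{{\bf a}}.$$ Both spaces are (in general singular) closed subsets of smooth manifolds (the flag manifold and $(S^2)^n$); ''diffeomorphic'' means there is a bijection between them which, together with its inverse, is smooth as a map between subsets of manifolds (locally extends to a smooth map of the ambient manifolds). In particular it is a homeomorphism. *)

(* Defs.v *)
From HB Require Import structures.
From mathcomp Require Import all_boot all_order all_algebra.
From mathcomp Require Import all_classical all_reals all_analysis.
From mathcomp Require Import complex ring.

Set Implicit Arguments.
Unset Strict Implicit.
Unset Printing Implicit Defensive.

Import Order.TTheory GRing.Theory Num.Theory.
Import numFieldNormedType.Exports.

Local Open Scope classical_set_scope.
Local Open Scope ring_scope.

Section SmoothMaps.
Context {R : realType}.

(* [U] is meant to be open, so that derivatives only see [f] on [U]. *)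
Fixpoint class_C (k : nat) (d e : nat) (U : set 'rV[R]_d)
    (f : 'rV[R]_d -> 'rV[R]_e) : Prop :=
  if k is k'.+1 then
    (forall x, U x -> differentiable f x) /\
    (forall v, class_C k' U (fun x => 'D_v f x))
  else forall x, U x -> {for x, continuous f}.

Definition class_Coo (d e : nat) (U : set 'rV[R]_d)
    (f : 'rV[R]_d -> 'rV[R]_e) : Prop :=
  forall k, class_C k U f.

(* A smooth manifold structure is given by inverses of charts: each [param i]
   is the inverse of a chart whose image is all of [R^dim].  The two instances
   below are classical atlases (injective parametrizations covering the carrier,
   with open overlaps and smooth transition maps). *)
Record atlas (M : Type) := Atlas {
  atlas_dim : nat;
  chart_index : Type;
  param : chart_index -> 'rV[R]_atlas_dim -> M
}.

Arguments param {M} a i x : rename.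

Definition manifold_open (M : Type) (aM : atlas M) (O : set M) : Prop :=
  forall i, open (param aM i @^-1` O).

(* For all charts [i] of [M] and [j] of [N]: the set where the coordinate
   expression of [F] is defined is open, and that expression, [g], is C^oo.
   The openness for every [j] encodes the continuity of [F] on [O]. *)
Definition smooth_on_open (M N : Type) (aM : atlas M) (aN : atlas N)
    (O : set M) (F : M -> N) : Prop :=
  forall (i : chart_index aM) (j : chart_index aN),
    let W := [set x | O (param aM i x) /\
                      range (param aN j) (F (param aM i x))] in
    open W /\
    exists2 g : 'rV[R]_(atlas_dim aM) -> 'rV[R]_(atlas_dim aN),
      class_Coo W g &
      forall x, W x -> param aN j (g x) = F (param aM i x).

Definition smooth_on_subset (M N : Type) (aM : atlas M) (aN : atlas N)
    (A : set M) (f : M -> N) : Prop :=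
  forall a, A a -> exists (O : set M) (F : M -> N),
    [/\ manifold_open aM O, O a, smooth_on_open aM aN O F &
        forall x, A x -> O x -> F x = f x].

(* The values of [f] outside [A] and of [g] outside [B] are irrelevant. *)
Definition diffeomorphic (M N : Type) (aM : atlas M) (aN : atlas N)
    (A : set M) (B : set N) : Prop :=
  exists (f : M -> N) (g : N -> M),
    [/\ (forall x, A x -> B (f x)) /\ (forall y, B y -> A (g y)),
        forall x, A x -> g (f x) = x,
        forall y, B y -> f (g y) = y,
        smooth_on_subset aM aN A f &
        smooth_on_subset aN aM B g].

End SmoothMaps.

Section Flags.
Variable (R : realType) (n : nat).

Local Notation C := R[i].

(* [V i] is the space [V_(i+1)]; in particular [V_n = C^n] by dimension. *)
Definition is_complete_flag (V : {ffun 'I_n -> {vspace 'rV[C]_n}}) : bool :=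
  [forall i : 'I_n, \dim (V i) == i.+1] &&
  [forall i : 'I_n, forall j : 'I_n, (i <= j)%N ==> (V i <= V j)%VS].

Definition flag := {V : {ffun 'I_n -> {vspace 'rV[C]_n}} | is_complete_flag V}.

Definition row_flag_fun (h : 'M[C]_n) : {ffun 'I_n -> {vspace 'rV[C]_n}} :=
  [ffun i : 'I_n => <<[seq row j h | j : 'I_n <- enum 'I_n & (j <= i)%N]>>%VS].

Lemma row_flag_subproof (h : 'M[C]_n) :
  h \in unitmx -> is_complete_flag (row_flag_fun h).
Proof.
move=> hu; apply/andP; split; last first.
  apply/forallP => i; apply/forallP => j; apply/implyP => ij.
  rewrite !ffunE; apply: sub_span => _ /mapP[l + ->].
  rewrite mem_filter => /andP[li _]; apply: map_f.
  by rewrite mem_filter mem_enum (leq_trans li ij).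
apply/forallP => i; rewrite ffunE.
set s := [seq _ | _ <- _ & _].
have size_s : size s = i.+1.
  rewrite size_map size_filter -(count_map (@nat_of_ord n) (fun m => (m <= i)%N)).
  rewrite val_enum_ord -size_filter.
  have -> : [seq m <- iota 0 n | (m <= i)%N] = iota 0 i.+1.
    rewrite -[X in iota 0 X](subnKC (ltn_ord i)) iotaD filter_cat.
    rewrite (_ : [seq m <- iota 0 _ | _] = iota 0 i.+1); last first.
      by apply/all_filterP/allP => m; rewrite mem_iota.
    rewrite (_ : [seq m <- iota _ _ | _] = [::]) ?cats0 //.
    apply/eqP; rewrite -(negbK (_ == _)) -has_filter; apply/hasPn => m.
    by rewrite mem_iota add0n -ltnNge => /andP[].
  by rewrite size_iota.
suff : free s by move/eqP; rewrite size_s => ->.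
have sub : subseq s [seq row j h | j <- enum 'I_n].
  by apply: map_subseq; exact: filter_subseq.
suff fr : free [seq row j h | j <- enum 'I_n].
  have [m _ ->] := subseqP sub.
  elim: m [seq _ | _ <- _] fr => [|b m IHm] [|x t] //=; rewrite ?nil_free//.
  rewrite free_cons => /andP[xt ft].
  case: b => /=; last exact: IHm.
  rewrite free_cons IHm // andbT; apply: contra xt; apply: subvP.
  by apply: sub_span => y /mem_mask.
pose X : n.-tuple 'rV[C]_n := [tuple row j h | j < n].
rewrite (_ : [seq _ | _ <- _] = X); last by rewrite -val_ord_tuple.
apply/freeP => c; under eq_bigr => j _.
  rewrite -tnth_nth tnth_mktuple; over.
move=> c0 j; have : (\row_l c l) *m h = 0.
  by rewrite mulmx_sum_row -[RHS]c0; apply: eq_bigr => l _; rewrite mxE.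
move/(congr1 (mulmx^~ (invmx h))); rewrite mulmxK // mul0mx.
by move/rowP/(_ j); rewrite !mxE.
Qed.

Definition row_flag (h : 'M[C]_n) (hu : h \in unitmx) : flag :=
  exist _ (row_flag_fun h) (row_flag_subproof hu).

Definition upper_pairs : {set 'I_n * 'I_n} :=
  [set p : 'I_n * 'I_n | (p.1 < p.2)%N].

(* The upper unitriangular matrix whose strictly upper entries have real parts
   [lsubmx x] and imaginary parts [rsubmx x]. *)
Definition unitri (x : 'rV[R]_(#|upper_pairs| + #|upper_pairs|)) : 'M[C]_n :=
  1%:M + \sum_(t < #|upper_pairs|)
    Complex (lsubmx x 0 t) (rsubmx x 0 t) *:
      delta_mx (enum_val t).1 (enum_val t).2.

Lemma unitri_unit (x : 'rV[R]_(#|upper_pairs| + #|upper_pairs|)) :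
  unitri x \in unitmx.
Proof.
have E (i j : 'I_n) : (j <= i)%N -> unitri x i j = (i == j)%:R.
  move=> ji; rewrite !mxE summxE big1 ?addr0 // => t _.
  have := enum_valP t; rewrite inE !mxE.
  case: (enum_val t) => a b /= ab.
  case: eqP => [ia|]; case: eqP => [jb|]; rewrite ?mulr0 //.
  by move: ab; rewrite -ia -jb ltnNge ji.
rewrite -unitmx_tr unitmxE det_trig; last first.
  by apply/is_trig_mxP => i j ij; rewrite mxE E ?(ltnW ij)// -val_eqE gtn_eqF.
by rewrite big1 ?unitr1 // => i _; rewrite mxE E // eqxx.
Qed.

Lemma unitri_mul_unit (g : {g : 'M[C]_n | g \in unitmx})
    (x : 'rV[R]_(#|upper_pairs| + #|upper_pairs|)) :
  unitri x *m val g \in unitmx.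
Proof. by rewrite unitmx_mul unitri_unit (valP g). Qed.

(* The chart centred at the flag of the rows of [g] : the big cell of the flags
   transverse to the opposite flag of [g]. *)
Definition flag_atlas : @atlas R flag :=
  Atlas (fun (g : {g : 'M[C]_n | g \in unitmx}) x =>
           row_flag (unitri_mul_unit g x)).

(* [Gamma] is nilpotent with Jordan blocks of sizes [n - k] and [k] (a single
   block if [k = 0]): in some basis [e_0, ..., e_(n-1)], it acts by
     e_(n-k-1) |-> ... |-> e_0 |-> 0  and  e_(n-1) |-> ... |-> e_(n-k) |-> 0. *)
Definition nilpotent_two_blocks (k : nat) (Gamma : 'End('rV[C]_n)) : Prop :=
  exists2 e : n.-tuple 'rV[C]_n, basis_of fullv e &
    forall i : 'I_n,
      Gamma e`_i = if (i == 0 :> nat) || (i == n - k :> nat)%N then 0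
                   else e`_i.-1.

Definition springer (Gamma : 'End('rV[C]_n)) : set flag :=
  [set V : flag | forall i : 'I_n, (Gamma @: sval V i <= sval V i)%VS].

End Flags.

Record matching (n : nat) := Matching {
  arcs : {set 'I_n * 'I_n};
  rays : {set 'I_n}
}.

(* Vertex [i : 'I_n] is the vertex numbered [i + 1]. *)
Definition noncrossing_matching (n k : nat) (a : matching n) : Prop :=
  [/\ #|arcs a| = k /\ #|rays a| = (n - k.*2)%N,
      forall e, e \in arcs a -> (e.1 < e.2)%N,
      forall v : 'I_n,
        (#|[set e in arcs a | (v == e.1) || (v == e.2)]| + (v \in rays a))%N
          = 1%N,
      forall e f, e \in arcs a -> f \in arcs a ->
        ~~ [&& e.1 < f.1, f.1 < e.2 & e.2 < f.2]%N &
      forall e v, e \in arcs a -> v \in rays a -> ~~ (e.1 < v < e.2)%N].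

Section Spheres.
Variable R : realType.

Definition sphere := {v : 'rV[R]_3 | \sum_j v 0 j ^+ 2 == 1}.

Definition north : 'rV[R]_3 := delta_mx 0 ord_max.

(* Inverse stereographic projection from [(-1)^s p]. *)
Definition stereo_fun (s : bool) (w : 'rV[R]_2) : 'rV[R]_3 :=
  let t := \sum_j w 0 j ^+ 2 in
  (1 + t)^-1 *: @row_mx R 1 2 1 (2 *: w) ((-1) ^+ s * (t - 1))%:M.

Lemma stereo_subproof (s : bool) (w : 'rV[R]_2) :
  \sum_j stereo_fun s w 0 j ^+ 2 == 1.
Proof.
pose t := \sum_j w 0 j ^+ 2; have t0 : 0 <= t.
  by apply: sumr_ge0 => j _; exact: sqr_ge0.
have t1 : (1 + t) ^+ 2 != 0 by rewrite expf_neq0 // gt_eqF // ltr_pwDl.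
apply/eqP; transitivity
    ((1 + t)^-1 ^+ 2 *
     (\sum_(j < 2) (2 * w 0 j) ^+ 2 + ((-1) ^+ s * (t - 1)) ^+ 2)).
  under eq_bigr do rewrite mxE exprMn; rewrite -mulr_sumr; congr (_ * _).
  rewrite (@big_split_ord _ _ _ 2 1) big_ord1 /=; congr (_ + _).
    by apply: eq_bigr => j _; rewrite row_mxEl mxE.
  by rewrite row_mxEr mxE eqxx mulr1n.
under eq_bigr do rewrite exprMn; rewrite -mulr_sumr -/t.
rewrite exprMn sqrr_sign mul1r exprVn.
apply: (mulfI t1); rewrite mulVKf // mulr1 sqrrB1 sqrrD1.
by ring.
Qed.

Definition stereo (s : bool) (w : 'rV[R]_2) : sphere :=
  exist _ (stereo_fun s w) (stereo_subproof s w).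

Variable n : nat.

Definition spheres_atlas : @atlas R {ffun 'I_n -> sphere} :=
  Atlas (fun (s : 'I_n -> bool) (x : 'rV[R]_(n * 2)) =>
           [ffun i => stereo (s i) (row i (vec_mx x))]).

Definition S_matching (a : matching n) : set {ffun 'I_n -> sphere} :=
  [set x | (forall i j, (i, j) \in arcs a -> x i = x j) /\
           (forall i, i \in rays a -> val (x i) = (-1) ^+ i.+1 *: north)].

Definition X_space (k : nat) : set {ffun 'I_n -> sphere} :=
  \bigcup_(a in [set a | noncrossing_matching k a]) S_matching a.

End Spheres.

Arguments X_space : clear implicits.

(* Main.v *)
(** Identify [C^n], through a Jordan basis of [Gamma], with the pairs of polynomials
    of degrees [< n - k] and [< k]; then [Gamma] is the backward shift, dividing by
    [t] and dropping constants.  A point [x] of the sphere is a line in [C^2], with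
    orthogonal projector [P_x], and defines the factor [F_x = (1 - P_x) + t P_x],
    which is unitary on the circle [|t| = 1] and is [1] at [t = 1].  For points
    [x_0, ..., x_(n-1)] put [Phi_i = F_(x_0) ... F_(x_(i-1))].  The vectors
    [u_i = Phi_i w_i], with [w_i] spanning the line of [x_i], are orthogonal, and
    [L_i = span (u_0, ..., u_(i-1))] is a flag stable under the shift, with
    [u_i(1) = w_i].  Conversely, as [t L_i] is contained in [L_i + Phi_i C^2], every
    stable flag arises in this way, [w_i] being the value at [t = 1] of the vector
    of [V_(i+1)] orthogonal to [V_i].  The flag lives in [C^n] exactly when
    [Phi_n = diag (t^(n-k), t^k)].

    If [k > 0], the product of the rank one projectors [1 - P_(x_i)] vanishes, so two
    consecutive ones have product zero: two consecutive points are antipodal, their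
    factors multiply to [t], and they can be cancelled; this is an innermost arc.
    If [k = 0], all points are the north pole: these are the rays.  The sign
    [(-1)^(i+1)] turns "antipodal" into "equal".

    Both maps are rational in the charts: flags are handled through matrices of rows
    up to lower triangular factors, orthogonalization and chart transitions being
    eliminations in a Gram matrix and in a transition matrix. *)

Require Import Defs.
From mathcomp Require Import all_boot all_order all_algebra.
From mathcomp Require Import all_classical all_reals all_analysis.
From mathcomp Require Import complex ring lra zify.
Set Implicit Arguments.
Unset Strict Implicit.
Unset Printing Implicit Defensive.
Import Order.TTheory GRing.Theory Num.Theory.
Import numFieldNormedType.Exports.
Local Open Scope classical_set_scope.
Local Open Scope ring_scope.

(** * Rational functions are smooth *)

Section NearDifferentiable.
Context {K : realFieldType} {V W : normedModType K}.

(** Differentiability depends only on the germ: the expansion of [f] at [x] holds verbatim for [g],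
    and uniqueness of the differential identifies ['d g x] with ['d f x]. This serves functions
    known only on an open set. *)
Lemma near_eq_differentiable (f g : V -> W) (x : V) :
  (\forall y \near x, f y = g y) -> differentiable f x -> differentiable g x.
Proof.
move=> fg df.
have fgx : f x = g x by exact: nbhs_singleton fg.
have [dfc dfE] := (diff_locallyP _ _).1 df.
have H : g \o shift x = cst (g x) + 'd f x +o_ 0 id.
  apply/eqaddoP => e e0; move/eqaddoP: dfE => /(_ e e0).
  have : \forall h \near (0 : V), f (h + x) = g (h + x).
    by move: fg; rewrite (near_shift 0) /= subr0.
  apply: filterS2 => h /= E.
  by rewrite !fctE /= E fgx.
have E : 'd g x = 'd f x :> (V -> W) by exact: diff_unique.
by apply/diff_locallyP; rewrite E.
Qed.

End NearDifferentiable.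

Section Rational.
Context {R : realType} {d : nat}.
Implicit Types (U : set 'rV[R]_d) (f g : 'rV[R]_d -> R).

(** An inductive predicate, so that closure under differentiation is one induction. [rational_ext]
    ignores values outside [U], which absorbs the default values of totalized inverses. *)
Inductive rational_on U : ('rV[R]_d -> R) -> Prop :=
| rational_cst c : rational_on U (fun=> c)
| rational_coord j : rational_on U (fun x => x 0 j)
| rational_add f g : rational_on U f -> rational_on U g ->
    rational_on U (fun x => f x + g x)
| rational_mul f g : rational_on U f -> rational_on U g ->
    rational_on U (fun x => f x * g x)
| rational_inv f : (forall x, U x -> f x != 0) -> rational_on U f ->
    rational_on U (fun x => (f x)^-1)
| rational_ext f g : (forall x, U x -> f x = g x) -> rational_on U f ->
    rational_on U g.

Lemma rational_subset U V f : U `<=` V -> rational_on V f -> rational_on U f.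
Proof.
move=> UV; elim=> [c|j|g h _ gU _ hU|g h _ gU _ hU|g g0 _ gU|g h gh _ gU].
- exact: rational_cst.
- exact: rational_coord.
- exact: rational_add.
- exact: rational_mul.
- by apply: rational_inv => // x /UV; exact: g0.
- by apply: rational_ext gU => x /UV; exact: gh.
Qed.

Lemma rational_opp U f : rational_on U f -> rational_on U (fun x => - f x).
Proof.
move=> fU; apply: (@rational_ext _ (fun x => -1 * f x)).
  by move=> x _; rewrite mulN1r.
by apply: rational_mul => //; exact: rational_cst.
Qed.

Lemma rational_sum U (I : Type) (r : seq I) (P : pred I)
    (F : I -> 'rV[R]_d -> R) :
  (forall i, P i -> rational_on U (F i)) ->
  rational_on U (fun x => \sum_(i <- r | P i) F i x).
Proof.
move=> FU; elim: r => [|i r IH].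
  by apply: rational_ext (rational_cst _ 0) => x _; rewrite big_nil.
have [Pi|nPi] := boolP (P i).
  apply: rational_ext (rational_add (FU _ Pi) IH) => x _.
  by rewrite big_cons Pi.
by apply: rational_ext IH => x _; rewrite big_cons (negbTE nPi).
Qed.

(** The second component is the point: directional derivatives stay in the class, so smoothness of
    every order follows by iteration. *)
Lemma rational_differentiable U f : open U -> rational_on U f ->
  (forall x, U x -> differentiable f x) /\
  (forall v, exists2 f', rational_on U f' &
     forall x, U x -> is_derive x v f (f' x)).
Proof.
move=> Uo; elim=> [c|j|g h gr [gd gD] hr [hd hD]|g h gr [gd gD] hr [hd hD]|g g0 gr [gd gD]
  |g h gh gr [gd gD]].
- split=> [x _|v]; first exact: differentiable_cst.
  by exists (fun=> 0) => *; [exact: rational_cst|exact: is_derive_cst].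
- split=> [x _|v]; first exact: differentiable_coord.
  exists (fun=> v 0 j) => [|x _]; first exact: rational_cst.
  have dj : derivable (fun x : 'rV[R]_d => x 0 j) x v.
    exact/diff_derivable/differentiable_coord.
  apply: (is_derive_eq (derivableP dj)).
  have := derive_mx (@derivable_id _ _ x v).
  by rewrite derive_id => /rowP/(_ j); rewrite mxE.
- split=> [x Ux|v]; first by apply: differentiableD; [exact: gd|exact: hd].
  have [g' g'r g'D] := gD v; have [h' h'r h'D] := hD v.
  exists (fun x => g' x + h' x) => [|x Ux]; first exact: rational_add.
  by have := g'D _ Ux; have := h'D _ Ux => *; exact: is_deriveD.
- split=> [x Ux|v]; first by apply: differentiableM; [exact: gd|exact: hd].
  have [g' g'r g'D] := gD v; have [h' h'r h'D] := hD v.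
  exists (fun x => g x * h' x + h x * g' x) => [|x Ux].
    by apply: rational_add; apply: rational_mul.
  by have := g'D _ Ux; have := h'D _ Ux => *; exact: is_deriveM.
- split=> [x Ux|v]; first by apply: differentiableV; [exact: gd|exact: g0].
  have [g' g'r g'D] := gD v.
  exists (fun x => - ((g x)^-1 * (g x)^-1 * g' x)) => [|x Ux].
    apply: rational_opp; apply: rational_mul => //.
    by apply: rational_mul; apply: rational_inv.
  have dg := g'D _ Ux.
  have dgx : derivable g x v by [].
  apply: (is_derive_eq (derivableP (derivableV (g0 _ Ux) dgx))).
  rewrite deriveV ?g0 // derive_val -invfM -expr2.
  by rewrite -mulNr.
- have near_gh x : U x -> \forall y \near x, g y = h y.
    move=> Ux; near=> y; apply: gh.
    by near: y; exact: open_nbhs_nbhs.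
  split=> [x Ux|v].
    by apply: (near_eq_differentiable (near_gh _ Ux)); exact: gd.
  have [g' g'r g'D] := gD v; exists g' => // x Ux.
  by apply: (near_eq_is_derive (near_gh _ Ux)); exact: g'D.
Unshelve. all: by end_near.
Qed.

Lemma rational_continuous U f x : open U -> rational_on U f -> U x ->
  {for x, continuous f}.
Proof.
move=> Uo fU Ux; apply: differentiable_continuous.
exact: (rational_differentiable Uo fU).1.
Qed.

Lemma rational_open_neq0 U f : open U -> rational_on U f ->
  open [set x | U x /\ f x != 0].
Proof.
move=> Uo fU; rewrite openE => x [Ux fx].
have Un : nbhs x U by exact: open_nbhs_nbhs.
have cf := rational_continuous Uo fU Ux.
have fn : nbhs x (f @^-1` [set y | y != 0]).
  by apply: cf; apply: open_nbhs_nbhs; split => //; exact: (@open_neq R 0).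
by rewrite /interior; apply: filterS2 Un fn => y; split.
Qed.

Lemma differentiable_rV e (F : 'rV[R]_d -> 'rV[R]_e) x :
  (forall j, differentiable (fun y => F y 0 j) x) -> differentiable F x.
Proof.
move=> dF.
have -> : F = \sum_j (fun y => F y 0 j *: delta_mx 0 j).
  apply/funext => y; rewrite fct_sumE.
  by apply/rowP => j; rewrite [in LHS](row_sum_delta (F y)).
apply: differentiable_sum => j.
exact: differentiableZl.
Qed.

Lemma rational_class_Coo e U (F : 'rV[R]_d -> 'rV[R]_e) : open U ->
  (forall j, rational_on U (fun x => F x 0 j)) -> class_Coo U F.
Proof.
move=> Uo FU k; elim: k F FU => [|k IH] F FU /=.
  move=> x Ux; apply: differentiable_continuous; apply: differentiable_rV => j.
  exact: (rational_differentiable Uo (FU j)).1.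
have dF x : U x -> differentiable F x.
  move=> Ux; apply: differentiable_rV => j.
  exact: (rational_differentiable Uo (FU j)).1.
split=> // v; apply: IH => j.
have [f' f'r f'D] := (rational_differentiable Uo (FU j)).2 v.
apply: rational_ext f'r => x Ux.
rewrite derive_mx ?mxE; last exact/diff_derivable/dF.
by have dfx := f'D _ Ux; rewrite derive_val.
Qed.

End Rational.

(** * Rational functions with complex and matrix values *)

Section ComplexRational.
Context {R : realType} {d : nat}.
Local Notation C := R[i].
Implicit Types (U : set 'rV[R]_d) (f g : 'rV[R]_d -> C).

Definition crational_on U f :=
  rational_on U (fun x => complex.Re (f x)) /\
  rational_on U (fun x => complex.Im (f x)).

Lemma crational_ext U f g : (forall x, U x -> f x = g x) ->
  crational_on U f -> crational_on U g.
Proof.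
by move=> fg [f1 f2]; split; [apply: rational_ext f1|apply: rational_ext f2];
  move=> x Ux; rewrite fg.
Qed.

Lemma crational_subset U V f : U `<=` V -> crational_on V f -> crational_on U f.
Proof. by move=> UV [? ?]; split; apply: rational_subset; eauto. Qed.

Lemma crational_cst U c : crational_on U (fun=> c).
Proof. by split; exact: rational_cst. Qed.

Lemma crational_complex U (a b : 'rV[R]_d -> R) :
  rational_on U a -> rational_on U b ->
  crational_on U (fun x => Complex (a x) (b x)).
Proof. by []. Qed.

Lemma crational_add U f g : crational_on U f -> crational_on U g ->
  crational_on U (fun x => f x + g x).
Proof.
move=> [f1 f2] [g1 g2]; split.
  by apply: rational_ext (rational_add f1 g1) => x _; case: (f x) (g x) => ? ? [].
by apply: rational_ext (rational_add f2 g2) => x _; case: (f x) (g x) => ? ? [].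
Qed.

Lemma crational_mul U f g : crational_on U f -> crational_on U g ->
  crational_on U (fun x => f x * g x).
Proof.
move=> [f1 f2] [g1 g2]; split.
  apply: (rational_ext _ (rational_add (rational_mul f1 g1)
    (rational_opp (rational_mul f2 g2)))) => x _.
  by case: (f x) (g x) => ? ? [].
apply: (rational_ext _ (rational_add (rational_mul f1 g2)
  (rational_mul f2 g1))) => x _.
by case: (f x) (g x) => ? ? [].
Qed.

Lemma crational_conj U f : crational_on U f -> crational_on U (fun x => (f x)^*).
Proof.
move=> [f1 f2]; split.
  by apply: rational_ext f1 => x _; case: (f x).
by apply: rational_ext (rational_opp f2) => x _; case: (f x).
Qed.

Lemma complex_eq0_normsq (z : C) :
  (z == 0) = (complex.Re z ^+ 2 + complex.Im z ^+ 2 == 0).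
Proof.
case: z => a b /=; rewrite eq_complex /=.
by rewrite paddr_eq0 ?sqr_ge0 // !sqrf_eq0.
Qed.

Lemma crational_inv U f : (forall x, U x -> f x != 0) -> crational_on U f ->
  crational_on U (fun x => (f x)^-1).
Proof.
move=> f0 [f1 f2].
have N : rational_on U (fun x => (complex.Re (f x) ^+ 2 + complex.Im (f x) ^+ 2)^-1).
  apply: rational_inv; last by apply: rational_add; apply: rational_mul.
  by move=> x Ux; rewrite -complex_eq0_normsq f0.
split.
  by apply: rational_ext (rational_mul f1 N) => x _; case: (f x).
apply: rational_ext (rational_opp (rational_mul f2 N)) => x _.
by case: (f x).
Qed.

Lemma crational_sum U (I : Type) (r : seq I) (P : pred I)
    (F : I -> 'rV[R]_d -> C) :
  (forall i, P i -> crational_on U (F i)) ->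
  crational_on U (fun x => \sum_(i <- r | P i) F i x).
Proof.
move=> FU; elim: r => [|i r IH].
  by apply: crational_ext (crational_cst _ 0) => x _; rewrite big_nil.
have [Pi|nPi] := boolP (P i).
  apply: crational_ext (crational_add (FU _ Pi) IH) => x _.
  by rewrite big_cons Pi.
by apply: crational_ext IH => x _; rewrite big_cons (negbTE nPi).
Qed.

Lemma crational_prod U (I : Type) (r : seq I) (P : pred I)
    (F : I -> 'rV[R]_d -> C) :
  (forall i, P i -> crational_on U (F i)) ->
  crational_on U (fun x => \prod_(i <- r | P i) F i x).
Proof.
move=> FU; elim: r => [|i r IH].
  by apply: crational_ext (crational_cst _ 1) => x _; rewrite big_nil.
have [Pi|nPi] := boolP (P i).
  apply: crational_ext (crational_mul (FU _ Pi) IH) => x _.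
  by rewrite big_cons Pi.
by apply: crational_ext IH => x _; rewrite big_cons (negbTE nPi).
Qed.

Lemma crational_open_neq0 U f : open U -> crational_on U f ->
  open [set x | U x /\ f x != 0].
Proof.
move=> Uo [f1 f2].
have N : rational_on U (fun x => complex.Re (f x) ^+ 2 + complex.Im (f x) ^+ 2).
  by apply: rational_add; apply: rational_mul.
have := rational_open_neq0 Uo N; congr open; apply/seteqP.
by split=> x /= [Ux fx]; split=> //; move: fx; rewrite complex_eq0_normsq.
Qed.

Definition mx_rational_on U p q (M : 'rV[R]_d -> 'M[C]_(p, q)) :=
  forall i j, crational_on U (fun x => M x i j).

Lemma mx_rational_subset U V p q (M : 'rV[R]_d -> 'M[C]_(p, q)) :
  U `<=` V -> mx_rational_on V M -> mx_rational_on U M.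
Proof. by move=> UV MV i j; exact: crational_subset (MV i j). Qed.

Lemma mx_rational_cst U p q (M : 'M[C]_(p, q)) : mx_rational_on U (fun=> M).
Proof. by move=> i j; exact: crational_cst. Qed.

Lemma mx_rational_mul U p q r (M : 'rV[R]_d -> 'M[C]_(p, q))
    (N : 'rV[R]_d -> 'M[C]_(q, r)) :
  mx_rational_on U M -> mx_rational_on U N ->
  mx_rational_on U (fun x => M x *m N x).
Proof.
move=> MU NU i j; under eq_fun do rewrite mxE.
by apply: crational_sum => k _; exact: crational_mul.
Qed.

Lemma mx_rational_det U p (M : 'rV[R]_d -> 'M[C]_p) :
  mx_rational_on U M -> crational_on U (fun x => \det (M x)).
Proof.
move=> MU; rewrite /determinant; apply: crational_sum => s _.
by apply: crational_mul; [exact: crational_cst|exact: crational_prod].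
Qed.

Lemma mx_rational_invmx U p (M : 'rV[R]_d -> 'M[C]_p) :
  (forall x, U x -> M x \in unitmx) -> mx_rational_on U M ->
  mx_rational_on U (fun x => invmx (M x)).
Proof.
move=> Mu MU i j.
(* Cramer's rule, valid on [U] where the determinant is nonzero. *)
apply: (@crational_ext _ (fun x => (\det (M x))^-1 *
   ((-1) ^+ (j + i) * \det (row' j (col' i (M x)))))).
  by move=> x Ux; rewrite /invmx Mu // !mxE.
apply: crational_mul.
  apply: crational_inv; last exact: mx_rational_det.
  by move=> x Ux; rewrite -unitfE -unitmxE Mu.
apply: crational_mul; first exact: crational_cst.
by apply: mx_rational_det => a b; under eq_fun do rewrite !mxE; exact: MU.
Qed.

End ComplexRational.

(** * Triangular elimination and charts of the flag manifold *)

Section Elimination.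
Context {F : fieldType} {n : nat}.
Implicit Types (M L : 'M[F]_n) (m : nat).

(* The leading [m]-by-[m] block of [M], completed by an identity block so that
   its inverse is again an [n]-by-[n] matrix. *)
Definition lead_mx m M : 'M[F]_n :=
  \matrix_(i, j) if (i < m)%N && (j < m)%N then M i j else (i == j)%:R.

(** Gaussian elimination without pivoting, in closed form: when all leading blocks are invertible
    this is the lower triangular matrix whose product with [M] is upper unitriangular. Its entries
    are visibly rational in those of [M]. *)
Definition elim_mx M : 'M[F]_n := \matrix_(i, j) invmx (lead_mx i.+1 M) i j.

Lemma unitmx_ker M : (forall c : 'rV_n, c *m M = 0 -> c = 0) -> M \in unitmx.
Proof.
move=> M0; rewrite -row_free_unit -kermx_eq0; apply/eqP/row_matrixP => i.
by rewrite row0; apply: M0; rewrite -row_mul mulmx_ker row0.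
Qed.

(** The completed block is block diagonal, that is, it commutes with the projector [D] onto the
    first [m] coordinates. Hence so does its inverse, whose off-diagonal blocks then vanish. *)
Lemma invmx_lead m M (i l : 'I_n) : lead_mx m M \in unitmx ->
  (i < m <= l)%N -> invmx (lead_mx m M) i l = 0.
Proof.
set B := lead_mx m M => Bu /andP[im ml].
pose D : 'M[F]_n := \matrix_(a, b) ((a == b) && (a < m)%N)%:R.
have DMl (A : 'M[F]_n) a b : (D *m A) a b = (a < m)%N%:R * A a b.
  rewrite mxE (bigD1 a) //= big1 ?addr0 ?mxE ?eqxx // => c ca.
  by rewrite mxE eq_sym (negbTE ca) mul0r.
have DMr (A : 'M[F]_n) a b : (A *m D) a b = (b < m)%N%:R * A a b.
  rewrite mxE (bigD1 b) //= big1 ?addr0 ?mxE ?eqxx 1?mulrC // => c cb.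
  by rewrite mxE (negbTE cb) mulr0.
have DB : D *m B = B *m D.
  apply/matrixP => a b; rewrite DMl DMr !mxE.
  case: (ltnP a m); case: (ltnP b m) => //=; rewrite ?mul0r ?mul1r //;
    by case: eqP => // <- *; lia.
have DV : D *m invmx B = invmx B *m D.
  by rewrite -[D in LHS](mulKmx Bu) -DB -!mulmxA mulmxV // mulmx1.
move/matrixP/(_ i l): DV; rewrite DMl DMr im ltnNge ml /=.
by rewrite mul1r mul0r.
Qed.

Lemma elim_mx_trig M : (forall m, lead_mx m M \in unitmx) ->
  is_trig_mx (elim_mx M).
Proof.
move=> Mu; apply/is_trig_mxP => i j ij; rewrite mxE.
by apply: invmx_lead => //; rewrite ltnSn.
Qed.

Lemma elim_mxE M (i j : 'I_n) : (forall m, lead_mx m M \in unitmx) ->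
  (j <= i)%N -> (elim_mx M *m M) i j = (i == j)%:R.
Proof.
move=> Mu ji; have Bu := Mu i.+1.
have := mulVmx Bu => /matrixP/(_ i j); rewrite [RHS]mxE => <-.
rewrite !mxE; apply: eq_bigr => l _; rewrite !mxE.
have [li|il] := ltnP l i.+1; first by rewrite ltnS ji.
by rewrite invmx_lead ?ltnSn // !mul0r.
Qed.

(** A row of [L] of index below [m] vanishes in the columns from [m] on, so only indices below [m]
    contribute to the leading block of the product. *)
Lemma lead_mx_mul m L M : is_trig_mx L -> is_trig_mx M^T ->
  lead_mx m (L *m M) = lead_mx m L *m lead_mx m M.
Proof.
move=> /is_trig_mxP Lt /is_trig_mxP Mt.
have Mt' (i j : 'I_n) : (j < i)%N -> M i j = 0.
  by move=> ji; rewrite -(Mt _ _ ji) mxE.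
apply/matrixP => i j; rewrite !mxE.
have [im|mi] := ltnP i m; last first.
  rewrite /= (bigD1 i) //= big1 ?addr0.
    by rewrite !mxE ltnNge mi /= eqxx mul1r.
  by move=> l li; rewrite !mxE ltnNge mi /= eq_sym (negbTE li) mul0r.
rewrite /=; have [jm|mj] := ltnP j m.
  apply: eq_bigr => l _; rewrite !mxE im jm.
  have [lm|ml] //= := ltnP l m.
  rewrite Lt ?(leq_trans im) // mul0r; case: eqP => [E|_]; last by rewrite mul0r.
  by move: ml; rewrite -E leqNgt im.
rewrite (bigD1 j) //= big1 ?addr0.
  by rewrite !mxE [(j < m)%N]ltnNge mj !andbF eqxx mulr1.
by move=> l lj; rewrite !mxE [(j < m)%N]ltnNge mj andbF (negbTE lj) mulr0.
Qed.

Lemma lead_mx_trig_unit m L : is_trig_mx L -> L \in unitmx ->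
  lead_mx m L \in unitmx.
Proof.
move=> Lt Lu; have Li i : L i i != 0.
  move: Lu; rewrite unitmxE det_trig // unitfE => /prodf_neq0; exact.
have mt : is_trig_mx (lead_mx m L).
  apply/is_trig_mxP => i j ij; rewrite mxE (is_trig_mxP Lt) //.
  by rewrite -val_eqE ltn_eqF //; case: ifP.
rewrite unitmxE det_trig // unitfE; apply/prodf_neq0 => i _.
by rewrite mxE eqxx; case: ifP => // _; rewrite oner_eq0.
Qed.

Lemma lead_mx_tr m M : lead_mx m M^T = (lead_mx m M)^T.
Proof. by apply/matrixP => i j; rewrite !mxE andbC eq_sym. Qed.

(** The converse of elimination: a matrix that factors as lower times upper triangular has
    invertible leading blocks. Together they turn membership in a big cell into the nonvanishing of
    minors. *)
Lemma trig_mul_lead_unit m L M : is_trig_mx L -> is_trig_mx M^T ->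
  L *m M \in unitmx -> lead_mx m (L *m M) \in unitmx.
Proof.
move=> Lt Mt; rewrite unitmx_mul => /andP[Lu Mu].
rewrite lead_mx_mul // unitmx_mul lead_mx_trig_unit //=.
by rewrite -unitmx_tr -lead_mx_tr lead_mx_trig_unit // unitmx_tr.
Qed.

End Elimination.

Section ElimRational.
Context {R : realType} {d n : nat}.

Lemma mx_rational_elim (U : set 'rV[R]_d) (M : 'rV[R]_d -> 'M[R[i]]_n) :
  (forall x, U x -> forall m, lead_mx m (M x) \in unitmx) ->
  mx_rational_on U M -> mx_rational_on U (fun x => elim_mx (M x)).
Proof.
move=> Mu MU i j; under eq_fun do rewrite mxE.
apply: (mx_rational_invmx (M := fun x => lead_mx i.+1 (M x))).
  by move=> x Ux; exact: Mu.
move=> a b; under eq_fun do rewrite mxE.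
by case: (_ && _); [exact: MU|exact: crational_cst].
Qed.

Lemma lead_mx_open (U : set 'rV[R]_d) (M : 'rV[R]_d -> 'M[R[i]]_n) :
  open U -> mx_rational_on U M ->
  open [set x | U x /\ forall m, lead_mx m (M x) \in unitmx].
Proof.
move=> Uo MU.
have -> : [set x | U x /\ forall m, lead_mx m (M x) \in unitmx] =
    [set x | U x /\ \prod_(m < n.+1) \det (lead_mx m (M x)) != 0].
  apply/seteqP; split=> x /= [Ux Mx]; split=> //.
    by apply/prodf_neq0 => i _; rewrite -unitfE -unitmxE.
  (* Leading blocks of size beyond [n] all equal the one of size [n], so finitely many determinants
     suffice. *)
  move=> m; have lt_min : (minn m n < n.+1)%N by rewrite ltnS geq_minr.
  move: Mx => /prodf_neq0/(_ (Ordinal lt_min) isT); rewrite -unitfE -unitmxE /=.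
  suff -> : lead_mx (minn m n) (M x) = lead_mx m (M x) by [].
  by apply/matrixP => i j; rewrite !mxE !leq_min !ltn_ord !andbT.
apply: (crational_open_neq0
  (f := fun x => \prod_(m < n.+1) \det (lead_mx m (M x))) Uo).
apply: crational_prod => m _.
apply: (mx_rational_det (M := fun x => lead_mx m (M x))) => a b.
under eq_fun do rewrite mxE.
by case: (_ && _); [exact: MU|exact: crational_cst].
Qed.

End ElimRational.

(** * Flags as invertible matrices up to lower triangular factors *)

Section RowFlags.
Context {R : realType} {n : nat}.
Local Notation C := R[i].
Implicit Types (h : 'M[C]_n) (V : flag R n).

Lemma row_flag_funP h (i : 'I_n) (v : 'rV[C]_n) :
  reflect (exists2 c : 'rV_n, (forall j : 'I_n, (i < j)%N -> c 0 j = 0) & v = c *m h)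
          (v \in row_flag_fun h i).
Proof.
rewrite ffunE span_def big_map big_filter big_enum_cond /=.
apply: (iffP memv_sumP) => [[vs vsP ->]|[c c0 ->]].
  have /choice[a aP] (j : 'I_n) : exists a, (j <= i)%N -> vs j = a *: row j h.
    have [ji|] := leqP j i; last by exists 0.
    by have /vlineP[a ->] := vsP j ji; exists a.
  exists (\row_j if (j <= i)%N then a j else 0).
    by move=> j ij; rewrite mxE leqNgt ij.
  rewrite mulmx_sum_row big_mkcond; apply: eq_bigr => j _; rewrite mxE.
  by case: ifP => [ji|_]; rewrite ?scale0r //; exact: aP.
exists (fun j => c 0 j *: row j h).
  by move=> j _; rewrite memvZ // memv_line.
rewrite mulmx_sum_row [RHS]big_mkcond; apply: eq_bigr => j _.
by case: leqP => // /c0 ->; rewrite scale0r.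
Qed.

Lemma row_flag_fun_mul h (L : 'M[C]_n) (i : 'I_n) : is_trig_mx L ->
  (row_flag_fun (L *m h) i <= row_flag_fun h i)%VS.
Proof.
move=> Lt; apply/subvP => v /row_flag_funP[c c0 ->].
apply/row_flag_funP; exists (c *m L); last by rewrite mulmxA.
move=> j ij; rewrite mxE big1 // => l _.
have [il|li] := ltnP i l; first by rewrite c0 ?mul0r.
by rewrite (is_trig_mxP Lt) ?mulr0 //; exact: leq_ltn_trans ij.
Qed.

(** A triangular factor gives one inclusion at each level, and equal dimensions make it an equality.
    Conversely, the coordinates of the rows of [h] in those of [h'] form the factor. *)
Lemma row_flag_eqP h h' (hu : h \in unitmx) (hu' : h' \in unitmx) :
  (exists2 L : 'M[C]_n, is_trig_mx L & h = L *m h') <->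
  row_flag hu = row_flag hu'.
Proof.
split=> [[L Lt hE]|].
  apply: val_inj; apply/ffunP => i /=; apply/eqP.
  rewrite eqEdim {1}hE row_flag_fun_mul //=.
  have /andP[/forallP/(_ i)/eqP -> _] := row_flag_subproof hu.
  by have /andP[/forallP/(_ i)/eqP -> _] := row_flag_subproof hu'.
move=> /(congr1 val)/= E.
have /choice[c cP] (i : 'I_n) : exists c : 'rV_n,
    (forall j : 'I_n, (i < j)%N -> c 0 j = 0) /\ row i h = c *m h'.
  have : row i h \in row_flag_fun h i.
    apply/row_flag_funP; exists (delta_mx 0 i); last by rewrite -rowE.
    by move=> j ij; rewrite mxE -[j == i]val_eqE gtn_eqF.
  by rewrite E => /row_flag_funP[c]; exists c.
exists (\matrix_i c i).
  by apply/is_trig_mxP => i j ij; rewrite mxE; exact: (cP i).1.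
by apply/row_matrixP => i; rewrite row_mul rowK; exact: (cP i).2.
Qed.

Lemma flag_dim V (i : 'I_n) : \dim (val V i) = i.+1.
Proof. by have /andP[/forallP/(_ i)/eqP] := valP V. Qed.

Lemma flag_le V (i j : 'I_n) : (i <= j)%N -> (val V i <= val V j)%VS.
Proof.
by have /andP[_ /forallP/(_ i)/forallP/(_ j)/implyP] := valP V.
Qed.

Lemma row_flag_surj V : exists h, exists hu : h \in unitmx, V = row_flag hu.
Proof.
(* The sum over all earlier subspaces stands for the preceding one; it is zero for the first
   index. *)
pose Vp (i : 'I_n) := (\sum_(j < n | (j < i)%N) val V j)%VS.
have /choice[w vP] (i : 'I_n) : exists v, v \in val V i /\ v \notin Vp i.
  suff Vpi : (\dim (Vp i) <= i)%N.
    suff /subvPn[v] : ~~ (val V i <= Vp i)%VS by exists v.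
    apply/negP => /dimvS; rewrite flag_dim => /leq_trans/(_ Vpi).
    by rewrite ltnn.
  case: (posnP i) => [i0|ip].
    by rewrite /Vp big_pred0 ?dimv0 // => j; rewrite i0.
  have pi : (i.-1 < n)%N by rewrite (leq_trans _ (ltn_ord i)) // ltnS leq_pred.
  rewrite -[leqRHS](prednK ip) -(flag_dim V (Ordinal pi)); apply: dimvS.
  by apply/subv_sumP => j ji; apply: flag_le => /=; rewrite -ltnS prednK.
pose h : 'M[C]_n := \matrix_i w i.
have rowh i : row i h = w i by rewrite rowK.
have hV (i : 'I_n) : row i h \in val V i by rewrite rowh; exact: (vP i).1.
have hu : h \in unitmx.
  apply: unitmx_ker => c ch; apply/eqP/negPn/negP => /rV0Pn[i0 ci0].
  (* With [i] the last index carrying a nonzero coefficient, the relation would put [w i] into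
     [Vp i]. *)
  have [i ci imax] := @arg_maxnP _ i0 (fun i => c 0 i != 0) val ci0.
  have [_ /negP] := vP i; apply.
  have -> : w i =
      - (c 0 i)^-1 *: \sum_(j < n | (j < i)%N) c 0 j *: row j h.
    apply: (scalerI ci); rewrite scalerA mulrN divff // scaleN1r -rowh.
    apply/eqP; rewrite -addr_eq0; apply/eqP.
    rewrite -[RHS]ch mulmx_sum_row [RHS](bigD1 i) //=.
    congr (_ + _); rewrite [RHS]big_mkcond [LHS]big_mkcond.
    apply: eq_bigr => j _; rewrite -val_eqE /=.
    case: ltngtP => // ij; have [->|cj] := eqVneq (c 0 j) 0.
      by rewrite scale0r.
    by have := imax j cj; rewrite /= leqNgt ij.
  rewrite memvZ //; apply: memv_suml => j ji; rewrite memvZ //.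
  by apply: subvP (hV j); rewrite (sumv_sup j).
exists h, hu; apply: val_inj; apply/ffunP => i /=; apply/eqP; rewrite eq_sym.
rewrite eqEdim flag_dim.
have /andP[/forallP/(_ i)/eqP -> _] := row_flag_subproof hu.
rewrite leqnn andbT; apply/subvP => v /row_flag_funP[c c0 ->].
rewrite mulmx_sum_row; apply: memv_suml => j _.
have [ij|ji] := ltnP i j; first by rewrite c0 // scale0r mem0v.
by rewrite memvZ //; apply: subvP (hV j); exact: flag_le.
Qed.

End RowFlags.

Section FlagCharts.
Context {R : realType} {n : nat}.
Local Notation C := R[i].
Implicit Types (x : 'rV[R]_(#|upper_pairs n| + #|upper_pairs n|))
  (h A : 'M[C]_n) (g : {g : 'M[C]_n | g \in unitmx}).

Definition flag_coord A : 'rV[R]_(#|upper_pairs n| + #|upper_pairs n|) :=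
  row_mx (\row_t complex.Re (A (enum_val t).1 (enum_val t).2))
         (\row_t complex.Im (A (enum_val t).1 (enum_val t).2)).

Lemma unitriE x (i j : 'I_n) : unitri x i j = (i == j)%:R +
  \sum_(t < #|upper_pairs n|) Complex (lsubmx x 0 t) (rsubmx x 0 t) *
    ((i == (enum_val t).1) && (j == (enum_val t).2))%:R.
Proof.
by rewrite !mxE summxE; congr (_ + _); apply: eq_bigr => t _; rewrite !mxE.
Qed.

Lemma unitri_lower x (i j : 'I_n) : (j <= i)%N -> unitri x i j = (i == j)%:R.
Proof.
move=> ji; rewrite unitriE big1 ?addr0 // => t _.
have := enum_valP t; rewrite inE; case: (enum_val t) => a b /= ab.
case: eqP => [ia|]; case: eqP => [jb|]; rewrite ?mulr0 //.
by move: ab; rewrite -ia -jb ltnNge ji.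
Qed.

Lemma unitri_flag_coord A : (forall i j : 'I_n, (j <= i)%N -> A i j = (i == j)%:R) ->
  unitri (flag_coord A) = A.
Proof.
move=> Al; apply/matrixP => i j; have [ji|ij] := leqP j i.
  by rewrite unitri_lower // Al.
rewrite unitriE -val_eqE ltn_eqF //= add0r.
have pij : (i, j) \in upper_pairs n by rewrite inE.
rewrite (bigD1 (enum_rank_in pij (i, j))) //= big1 ?addr0; last first.
  move=> t tij; rewrite [_ && _](_ : _ = false) ?mulr0 //.
  apply: contraNF tij => /andP[/eqP it /eqP jt].
  apply/eqP/enum_val_inj; rewrite enum_rankK_in // it jt.
  exact: surjective_pairing.
rewrite row_mxKl row_mxKr !mxE enum_rankK_in //= !eqxx mulr1.
by case: (A i j).
Qed.

Lemma mx_rational_unitri U : mx_rational_on U (@unitri R n).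
Proof.
move=> i j; under eq_fun do rewrite unitriE.
apply: crational_add; first exact: crational_cst.
apply: crational_sum => t _; apply: crational_mul; last exact: crational_cst.
by apply: crational_complex; under eq_fun do rewrite mxE; exact: rational_coord.
Qed.

(** Lying in the chart of [g] means that [h *m invmx (val g)] factors as lower triangular times
    upper unitriangular; the second factor carries the coordinates. *)
Lemma flag_chart_rangeP h (hu : h \in unitmx) g :
  range (@param _ _ (flag_atlas R n) g) (row_flag hu) <->
  forall m, lead_mx m (h *m invmx (val g)) \in unitmx.
Proof.
split=> [[x _ /esym/row_flag_eqP[L Lt E]] m|Au].
  have -> : h *m invmx (val g) = L *m unitri x.
    by rewrite E -!mulmxA mulmxV ?mulmx1 // (valP g).
  apply: trig_mul_lead_unit => //.
    apply/is_trig_mxP => i j ij; rewrite mxE unitri_lower 1?ltnW //.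
    by rewrite -val_eqE gtn_eqF.
  move: hu; rewrite E mulmxA unitmx_mul => /andP[]; exact.
pose A := h *m invmx (val g).
exists (flag_coord (elim_mx A *m A)) => //=.
apply/row_flag_eqP; exists (elim_mx A); first exact: elim_mx_trig.
rewrite unitri_flag_coord /A; last by move=> i j; exact: elim_mxE.
by rewrite -!mulmxA mulVmx ?mulmx1 // (valP g).
Qed.

End FlagCharts.

Section SmoothIntoFlags.
Context {R : realType} {n : nat}.
Local Notation C := R[i].

(** It suffices to lift [F], in each chart of the source, to a rational matrix of rows: elimination
    turns the lift into chart coordinates, and the minors of the lift cut out the open domain. *)
Lemma smooth_into_flags (M : Type) (aM : @atlas R M) (O : set M)
    (F : M -> flag R n) :
  manifold_open aM O ->
  (forall i : chart_index aM,
    exists2 H : 'rV[R]_(atlas_dim aM) -> 'M[C]_n,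
      mx_rational_on (@param _ _ aM i @^-1` O) H &
      forall x, O (param i x) ->
        exists hu : H x \in unitmx, F (param i x) = row_flag hu) ->
  smooth_on_open aM (flag_atlas R n) O F.
Proof.
move=> Oo HO i g; have [H Hr HF] := HO i.
pose O' := @param _ _ aM i @^-1` O; pose A x := H x *m invmx (val g).
have Ar : mx_rational_on O' A.
  by apply: mx_rational_mul => //; exact: mx_rational_cst.
set W := [set x | _ /\ _].
have WE : W = [set x | O' x /\ forall m, lead_mx m (A x) \in unitmx].
  apply/seteqP; split=> x [Ox Fx]; split=> //; have [hu E] := HF x Ox.
    by move: Fx; rewrite E => /flag_chart_rangeP; exact.
  by rewrite E; apply/flag_chart_rangeP.
have Wo : open W by rewrite WE; exact: lead_mx_open (Oo i) Ar.
have WO : W `<=` O' by move=> x [].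
have Wl x : W x -> forall m, lead_mx m (A x) \in unitmx by rewrite WE => -[].
split=> //; exists (fun x => flag_coord (elim_mx (A x) *m A x)).
  have Er : mx_rational_on W (fun x => elim_mx (A x) *m A x).
    apply: mx_rational_mul; last exact: mx_rational_subset Ar.
    by apply: mx_rational_elim => //; exact: mx_rational_subset Ar.
  apply: rational_class_Coo => // j; rewrite /flag_coord.
  case: (split_ordP j) => t ->.
    under eq_fun do rewrite row_mxEl mxE.
    exact: (Er _ _).1.
  under eq_fun do rewrite row_mxEr mxE.
  exact: (Er _ _).2.
move=> x Wx; have [Ox _] := Wx; have [hu ->] := HF x Ox.
apply/row_flag_eqP; exists (elim_mx (A x)); first exact: elim_mx_trig (Wl _ Wx).
rewrite unitri_flag_coord; last by move=> a b; apply: elim_mxE; exact: Wl.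
by rewrite /A -!mulmxA mulVmx ?mulmx1 // (valP g).
Qed.

End SmoothIntoFlags.

(** * Charts of the spheres *)

Section SmoothIntoSpheres.
Context {R : realType} {n : nat}.

(** Stereographic projection from the pole [(-1)^s p], written as a rational map on the ambient
    space. *)
Definition stereo_coord (s : bool) (v : 'rV[R]_3) : 'rV[R]_2 :=
  (1 - (-1) ^+ s * v 0 ord_max)^-1 *: (@lsubmx R 1 2 1 v).

Lemma sphereE (v : sphere R) : \sum_(j < 2) @lsubmx R 1 2 1 (val v) 0 j ^+ 2 =
  1 - val v 0 ord_max ^+ 2.
Proof.
have /eqP := valP v; rewrite (@big_split_ord _ _ _ 2 1) big_ord1 /=.
have -> : rshift 2 (0 : 'I_1) = ord_max by exact: val_inj.
move=> E; apply/eqP; rewrite eq_sym subr_eq -[X in X == _]E; apply/eqP.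
by congr (_ + _); apply: eq_bigr => j _; rewrite mxE.
Qed.

Lemma stereo_coordK (s : bool) (v : sphere R) : (-1) ^+ s * val v 0 ord_max != 1 ->
  stereo s (stereo_coord s (val v)) = v.
Proof.
move=> v1; apply: val_inj => /=.
set z := (-1) ^+ s * _ in v1; have z1 : 1 - z != 0 by rewrite subr_eq0 eq_sym.
have zE : val v 0 ord_max = (-1) ^+ s * z by rewrite signrMK.
have z2 : val v 0 ord_max ^+ 2 = z ^+ 2 by rewrite zE exprMn sqrr_sign mul1r.
rewrite /stereo_fun; set t := \sum_j _.
have tE : t = (1 + z) / (1 - z).
  rewrite /t; under eq_bigr do rewrite mxE exprMn.
  rewrite -mulr_sumr sphereE z2 -/z; field.
  exact: z1.
have t1 : 1 + t = 2 / (1 - z) by rewrite tE; field.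
rewrite t1; apply/rowP => j; rewrite mxE.
case: (@split_ordP 2 1 j) => l ->.
  rewrite row_mxEl !mxE -/z; field.
  by rewrite ?z1 ?pnatr_eq0.
rewrite (ord1 l) row_mxEr mxE eqxx mulr1n tE.
have -> : rshift 2 (0 : 'I_1) = ord_max by exact: val_inj.
by rewrite zE; field; rewrite ?z1 ?pnatr_eq0.
Qed.

Lemma stereo_pole (s : bool) w : (-1) ^+ s * val (@stereo R s w) 0 ord_max != 1.
Proof.
rewrite /= /stereo_fun; set t := \sum_j _.
have t0 : 0 <= t by apply: sumr_ge0 => j _; exact: sqr_ge0.
have t1 : 1 + t != 0 by rewrite gt_eqF // ltr_pwDl.
rewrite mxE.
have -> : (ord_max : 'I_3) = @rshift 2 1 0 by exact: val_inj.
rewrite row_mxEr mxE eqxx mulr1n mulrCA signrMK.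
apply/eqP => E; have : t - 1 = 1 + t.
  by rewrite -[LHS](mulVKf t1) E mulr1.
lra.
Qed.

Lemma spheres_chart_rangeP (s : 'I_n -> bool) (v : {ffun 'I_n -> sphere R}) :
  range (@param _ _ (spheres_atlas R n) s) v <->
  forall i, (-1) ^+ s i * val (v i) 0 ord_max != 1.
Proof.
split=> [[w _ <-] i|v1]; first by rewrite ffunE; exact: stereo_pole.
exists (mxvec (\matrix_i stereo_coord (s i) (val (v i)))) => //.
by apply/ffunP => i; rewrite ffunE mxvecK rowK stereo_coordK.
Qed.

(** Only the ambient coordinates have to be rational: stereographic projection is rational, and the
    chart domain is where the denominators [q j] are all nonzero. *)
Lemma smooth_into_spheres (M : Type) (aM : @atlas R M) (O : set M)
    (F : M -> {ffun 'I_n -> sphere R}) :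
  manifold_open aM O ->
  (forall (i : chart_index aM) j c,
    rational_on (@param _ _ aM i @^-1` O) (fun x => val (F (param i x) j) 0 c)) ->
  smooth_on_open aM (spheres_atlas R n) O F.
Proof.
move=> Oo FO i s; pose O' := @param _ _ aM i @^-1` O.
set W := [set x | _ /\ _].
pose q j x := 1 - (-1) ^+ s j * val (F (param i x) j) 0 ord_max.
have qr j : rational_on O' (q j).
  apply: rational_add; first exact: rational_cst.
  apply: rational_opp; apply: rational_mul; first exact: rational_cst.
  exact: FO.
have WE : W = [set x | O' x /\ \prod_j q j x != 0].
  apply/seteqP; split=> x [Ox Fx]; split=> //.
    apply/prodf_neq0 => j _; rewrite subr_eq0 eq_sym.
    by move/spheres_chart_rangeP : Fx; exact.
  apply/spheres_chart_rangeP => j; rewrite eq_sym -subr_eq0.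
  by move: Fx => /prodf_neq0; exact.
have Wo : open W.
  rewrite WE; apply: (rational_open_neq0 (f := fun x => \prod_j q j x)).
    exact: Oo i.
  have : forall r : seq 'I_n, rational_on O' (fun x => \prod_(j <- r) q j x).
    elim=> [|j r IH].
      by apply: rational_ext (rational_cst _ 1) => x _; rewrite big_nil.
    by apply: rational_ext (rational_mul (qr j) IH) => x _; rewrite big_cons.
  exact.
have WO : W `<=` O' by move=> x [].
split=> //.
exists (fun x => mxvec (\matrix_j stereo_coord (s j) (val (F (param i x) j)))).
  apply: rational_class_Coo => // l; case/mxvec_indexP: l => j c.
  under eq_fun do rewrite mxvecE mxE mxE mxE.
  apply: rational_mul; last exact: rational_subset WO (FO i j _).
  apply: rational_inv; last exact: rational_subset WO (qr j).
  move=> x; rewrite WE => -[_ /prodf_neq0]; exact.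
move=> x [_ /spheres_chart_rangeP Fx]; apply/ffunP => j.
by rewrite ffunE mxvecK rowK stereo_coordK.
Qed.

End SmoothIntoSpheres.

(** * Lines in the plane and points of the sphere *)

Section Pauli.
Context {R : realType}.
Local Notation C := R[i].
Local Notation "A ^*m" := (map_mx Num.conj (A^T)) (at level 8).
Implicit Types (v : 'rV[R]_3) (w : 'cV[C]_2).

Lemma ord2P (b : 'I_2) : b = 0 \/ b = 1.
Proof. by case: b => [[|[|]]] // ?; [left|right]; exact: val_inj. Qed.

Lemma matrix2P (T : Type) (A B : 'M[T]_2) : A 0 0 = B 0 0 -> A 0 1 = B 0 1 ->
  A 1 0 = B 1 0 -> A 1 1 = B 1 1 -> A = B.
Proof.
by move=> ? ? ? ?; apply/matrixP => i j; case: (ord2P i) => ->; case: (ord2P j) => ->.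
Qed.

Lemma col2P (T : Type) (A B : 'cV[T]_2) : A 0 0 = B 0 0 -> A 1 0 = B 1 0 -> A = B.
Proof.
by move=> ? ?; apply/matrixP => i j; rewrite (ord1 j); case: (ord2P i) => ->.
Qed.

Lemma row3P (T : Type) (A B : 'rV[T]_3) : A 0 0 = B 0 0 -> A 0 1 = B 0 1 ->
  A 0 ord_max = B 0 ord_max -> A = B.
Proof.
have E (i : 'I_3) : [\/ i = 0, i = 1 | i = ord_max].
  by case: i => [[|[|[|]]]] // ?; [constructor 1|constructor 2|constructor 3];
    exact: val_inj.
by move=> ? ? ?; apply/matrixP => i j; rewrite (ord1 i); case: (E j) => ->.
Qed.

Lemma mulmx2E (T : pzSemiRingType) m p (A : 'M[T]_(m, 2)) (B : 'M[T]_(2, p)) i j :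
  (A *m B) i j = A i 0 * B 0 j + A i 1 * B 1 j.
Proof.
rewrite mxE big_ord_recl big_ord1; congr (_ + A i _ * B _ j); exact: val_inj.
Qed.

Lemma sum3E (F : 'I_3 -> R) : \sum_j F j = F 0 + F 1 + F ord_max.
Proof.
rewrite !big_ord_recl big_ord0 addr0 addrA; congr (_ + F _ + F _); exact: val_inj.
Qed.

(* The orthogonal projector of [C^2] onto the line that [v] represents under the
   identification of the sphere with [CP^1]; [pauli (- v)] is the projector onto
   the orthogonal line. *)
Definition pauli v : 'M[C]_2 :=
  \matrix_(i, j) if i == j then Complex ((1 + (-1) ^+ i * v 0 ord_max) / 2) 0
                 else Complex (v 0 0 / 2) (- (-1) ^+ i * v 0 1 / 2).

Lemma pauliE v : (pauli v 0 0 = Complex ((1 + v 0 ord_max) / 2) 0) *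
  (pauli v 0 1 = Complex (v 0 0 / 2) (- v 0 1 / 2)) *
  (pauli v 1 0 = Complex (v 0 0 / 2) (v 0 1 / 2)) *
  (pauli v 1 1 = Complex ((1 - v 0 ord_max) / 2) 0).
Proof. by rewrite !mxE /= expr0 expr1 !mul1r !mulN1r opprK mul1r. Qed.

Lemma complexP (x y : C) : complex.Re x = complex.Re y ->
  complex.Im x = complex.Im y -> x = y.
Proof. by case: x y => a b [c d] /= -> ->. Qed.

Lemma pauliN v : pauli (- v) = 1%:M - pauli v.
Proof.
apply: matrix2P; rewrite !pauliE !mxE; apply: complexP => /=; rewrite ?mxE; by field.
Qed.

Lemma pauli_adj v : (pauli v)^*m = pauli v.
Proof.
apply: matrix2P; rewrite ![map_mx _ _ _ _]mxE ![(_^T) _ _]mxE !pauliE;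
  apply: complexP => /=; by field.
Qed.

Lemma pauli_tr v : \tr (pauli v) = 1.
Proof.
rewrite /mxtrace big_ord_recl big_ord1.
have -> : lift ord0 (ord0 : 'I_1) = 1 :> 'I_2 by exact: val_inj.
by rewrite !pauliE; apply: complexP => /=; field.
Qed.

Lemma pauli_idem v : \sum_j v 0 j ^+ 2 = 1 -> pauli v *m pauli v = pauli v.
Proof.
rewrite sum3E => v1.
apply: matrix2P; rewrite mulmx2E !pauliE; apply: complexP => /=; nra.
Qed.

Lemma pauli_mulN v : \sum_j v 0 j ^+ 2 = 1 -> pauli v *m pauli (- v) = 0.
Proof. by move=> v1; rewrite pauliN mulmxBr mulmx1 pauli_idem // subrr. Qed.

Lemma pauli_Nmul v : \sum_j v 0 j ^+ 2 = 1 -> pauli (- v) *m pauli v = 0.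
Proof. by move=> v1; rewrite pauliN mulmxBl mul1mx pauli_idem // subrr. Qed.

Lemma sphere_opp v : \sum_j (- v) 0 j ^+ 2 = \sum_j v 0 j ^+ 2.
Proof. by apply: eq_bigr => j _; rewrite mxE sqrrN. Qed.

(** The trace of the product is half of one plus the scalar product of [v] and [v']. If it vanishes,
    the scalar product is -1, whence [v + v'] has norm zero. *)
Lemma pauli_mul_eq0 v v' : \sum_j v 0 j ^+ 2 = 1 -> \sum_j v' 0 j ^+ 2 = 1 ->
  pauli v *m pauli v' = 0 -> v' = - v.
Proof.
rewrite !sum3E => v1 v1' /(congr1 mxtrace); rewrite mxtrace0 /mxtrace.
rewrite big_ord_recl big_ord1.
have -> : lift ord0 (ord0 : 'I_1) = 1 :> 'I_2 by exact: val_inj.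
rewrite !mulmx2E !pauliE => /(congr1 (@complex.Re R)) /= E.
have S : (v 0 0 + v' 0 0) ^+ 2 + (v 0 1 + v' 0 1) ^+ 2 +
    (v 0 ord_max + v' 0 ord_max) ^+ 2 = 0 by nra.
move/eqP: S; rewrite !paddr_eq0 ?addr_ge0 ?sqr_ge0 // !sqrf_eq0.
move=> /andP[/andP[/eqP S0 /eqP S1] /eqP S2].
by apply: row3P; rewrite mxE; lra.
Qed.

Lemma pauli_neq0 v : pauli v != 0.
Proof.
apply: contra_eq_neq (pauli_tr v) => ->.
by rewrite mxtrace0 eq_sym oner_eq0.
Qed.

Definition normsq w : R := complex.Re (w 0 0) ^+ 2 + complex.Im (w 0 0) ^+ 2 +
  (complex.Re (w 1 0) ^+ 2 + complex.Im (w 1 0) ^+ 2).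

(* The point representing the line of [w] (the zero vector if [w = 0]). *)
Definition hopf w : 'rV[R]_3 :=
  let z := w 1 0 * (w 0 0)^* in
  (normsq w)^-1 *: \row_j (if j == 0 then 2 * complex.Re z
    else if j == 1 then 2 * complex.Im z
    else complex.Re (w 0 0) ^+ 2 + complex.Im (w 0 0) ^+ 2 -
      (complex.Re (w 1 0) ^+ 2 + complex.Im (w 1 0) ^+ 2)).

Lemma normsq_eq0 w : (normsq w == 0) = (w == 0).
Proof.
rewrite /normsq paddr_eq0 ?addr_ge0 ?sqr_ge0 // -!complex_eq0_normsq.
apply/andP/eqP => [[/eqP a /eqP b]|->]; last by rewrite !mxE.
by apply: col2P; rewrite !mxE.
Qed.

Lemma hopf_fix w : w != 0 -> pauli (hopf w) *m w = w.
Proof.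
rewrite -normsq_eq0 /normsq => N0.
apply: col2P; rewrite mulmx2E !pauliE !mxE /= /normsq; move: N0.
  case: (w 0 0) (w 1 0) => a b [c d] /= N0.
  by apply: complexP => /=; field.
case: (w 0 0) (w 1 0) => a b [c d] /= N0.
by apply: complexP => /=; field.
Qed.

Lemma hopf_unit w : w != 0 -> \sum_j hopf w 0 j ^+ 2 = 1.
Proof.
rewrite -normsq_eq0 /normsq sum3E => N0.
rewrite !mxE /= /normsq; move: N0.
case: (w 0 0) (w 1 0) => a b [c d] /= N0.
by field.
Qed.

Lemma hopf_unique v w : w != 0 -> pauli v *m w = w -> hopf w = v.
Proof.
rewrite -normsq_eq0 /normsq => N0 E.
have E0 := congr1 (fun A : 'cV[C]_2 => A 0 0) E.
have E1 := congr1 (fun A : 'cV[C]_2 => A 1 0) E.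
apply: row3P; rewrite !mxE /= /normsq.
all: move: N0 E0 E1; rewrite !mulmx2E !pauliE.
all: case: (w 0 0) (w 1 0) => a b [c d] /= N0 [e1 e2] [e3 e4].
all: apply: (mulfI N0); rewrite mulVKf //.
(* The fixed point equation consists of four real equations linear in [v]. Multiplied by the four
   real coordinates of [w], they combine linearly into [normsq w] times each coordinate of [v]. *)
all: have M (x y z : R) : x = y -> x * z = y * z by move=> ->.
all: have := M _ _ a e1; have := M _ _ b e1; have := M _ _ c e1; have := M _ _ d e1.
all: have := M _ _ a e2; have := M _ _ b e2; have := M _ _ c e2; have := M _ _ d e2.
all: have := M _ _ a e3; have := M _ _ b e3; have := M _ _ c e3; have := M _ _ d e3.
all: have := M _ _ a e4; have := M _ _ b e4; have := M _ _ c e4; have := M _ _ d e4.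
all: clear; lra.
Qed.

Lemma pauli_im v : exists2 w, w != 0 & exists c : 'cV[C]_2, w = pauli v *m c.
Proof.
have /matrix0Pn[i [j vij]] := pauli_neq0 v.
exists (col j (pauli v)); last by exists (delta_mx j 0); rewrite -colE.
by apply: contraNneq vij => /matrixP/(_ i 0); rewrite !mxE => ->.
Qed.

Lemma pauli_rank1 v : \sum_j v 0 j ^+ 2 = 1 -> exists (w : 'cV[C]_2) (u : 'rV[C]_2),
  [/\ w != 0, u != 0 & pauli v = w *m u].
Proof.
move=> v1; have [w w0 [c wE]] := pauli_im v.
have wv : pauli v *m w = w by rewrite wE mulmxA pauli_idem.
(* The orthogonal projector onto the line of [w] is [w] times its adjoint, divided by the squared
   norm. *)
exists w, ((normsq w)^-1%:C%C *: w^*m); split=> //.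
  rewrite scaler_eq0 negb_or; apply/andP; split.
    by rewrite fmorph_eq0 invr_eq0 normsq_eq0.
  rewrite map_mx_eq0 ?trmx_eq0 //.
rewrite -(hopf_unique w0 wv); move: w0; rewrite -normsq_eq0 /normsq => N0.
apply: matrix2P; rewrite !pauliE !mxE big_ord1 !mxE /= /normsq.
all: move: N0; case: (w 0 0) (w 1 0) => a b [e d] /= N0.
all: by apply: complexP => /=; field.
Qed.

End Pauli.

(** * Products of linear factors *)

Section Factors.
Context {R : realType}.
Local Notation C := R[i].
Local Notation PV := 'cV[{poly C}]_2.
Local Notation "A ^*m" := (map_mx Num.conj (A^T)) (at level 8).
Local Notation "A %:PM" := (map_mx polyC A) (at level 2).
Implicit Types (v : 'rV[R]_3) (w : 'cV[C]_2) (p q : PV).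

Definition unit_vec v := \sum_j v 0 j ^+ 2 = 1.

(* Unitary for [|t| = 1] and equal to [1] at [t = 1]. *)
Definition lfactor v : 'M[{poly C}]_2 := (pauli (- v))%:PM + 'X *: (pauli v)%:PM.

Lemma unit_vecN v : unit_vec v -> unit_vec (- v).
Proof. by rewrite /unit_vec sphere_opp. Qed.

(** Passing to the antipode exchanges the two complementary projectors: in the product only the
    terms of degree one survive, and they add up to the identity. *)
Lemma lfactor_mulN v : unit_vec v -> lfactor v *m lfactor (- v) = 'X%:M.
Proof.
move=> v1; rewrite /lfactor opprK mulmxDl !mulmxDr -!scalemxAl -!scalemxAr -!map_mxM.
rewrite pauli_Nmul // pauli_mulN // !pauli_idem ?sphere_opp // !map_mx0 !scaler0.
rewrite add0r addr0 -scalerDr -raddfD /= pauliN subrK map_scalar_mx /=.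
by rewrite scale_scalar_mx mulr1.
Qed.

Lemma lfactor_one v : map_mx (horner_eval 1) (lfactor v) = 1%:M.
Proof.
apply/matrixP => i j; rewrite /lfactor !mxE -/(pauli _ _ _) /horner_eval !hornerE.
have /matrixP/(_ i j) := pauliN v; rewrite !mxE => ->.
by rewrite subrK.
Qed.

Lemma lfactor_im v w : pauli v *m w = w -> lfactor v *m w%:PM = 'X *: w%:PM.
Proof.
move=> vw; rewrite /lfactor mulmxDl -scalemxAl -!map_mxM vw pauliN mulmxBl vw.
by rewrite mul1mx subrr map_mx0 add0r.
Qed.

Lemma lfactor_ker v w : pauli v *m w = 0 -> lfactor v *m w%:PM = w%:PM.
Proof.
move=> vw; rewrite /lfactor mulmxDl -scalemxAl -!map_mxM vw pauliN mulmxBl vw.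
by rewrite mul1mx subr0 map_mx0 scaler0 addr0.
Qed.

Lemma lfactorE v : lfactor v = 1 + ('X - 1) *: (pauli v)%:PM.
Proof.
by rewrite /lfactor pauliN raddfB /= map_scalar_mx /= scalerBl scale1r addrAC -addrA.
Qed.

Definition cf m p : 'cV[C]_2 := map_mx (coefp m) p.

Lemma cfD m p q : cf m (p + q) = cf m p + cf m q.
Proof. by apply/matrixP => i j; rewrite !mxE /= coefD. Qed.

Lemma cfB m p q : cf m (p - q) = cf m p - cf m q.
Proof. by apply/matrixP => i j; rewrite !mxE /= coefB. Qed.

Lemma cf0 m : cf m 0 = 0.
Proof. by apply/matrixP => i j; rewrite !mxE /= coef0. Qed.

Lemma cfXS m p : cf m.+1 ('X *: p) = cf m p.
Proof. by apply/matrixP => i j; rewrite !mxE /= coefXM. Qed.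

Lemma cfX0 p : cf 0 ('X *: p) = 0.
Proof. by apply/matrixP => i j; rewrite !mxE /= coefXM. Qed.

Lemma cfC m w : cf m w%:PM = if m == 0%N then w else 0.
Proof. by apply/matrixP => i j; rewrite !mxE /= coefC; case: eqP; rewrite ?mxE. Qed.

Lemma cfZ m (a : C) p : cf m (a%:P *: p) = a *: cf m p.
Proof. by apply/matrixP => i j; rewrite !mxE /= coefCM. Qed.

Lemma cf_mulC m (A : 'M[C]_2) p : cf m (A%:PM *m p) = A *m cf m p.
Proof.
apply/matrixP => i j; rewrite !mxE /= coef_sum; apply: eq_bigr => l _.
by rewrite !mxE coefCM.
Qed.

Lemma cfP p q : (forall m, cf m p = cf m q) -> p = q.
Proof.
move=> E; apply/matrixP => i j; apply/polyP => m.
by have /matrixP/(_ i j) := E m; rewrite !mxE /=.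
Qed.

Lemma cf_lfactorS m v p :
  cf m.+1 (lfactor v *m p) = pauli (- v) *m cf m.+1 p + pauli v *m cf m p.
Proof. by rewrite /lfactor mulmxDl -scalemxAl cfD cfXS !cf_mulC. Qed.

Lemma cf_lfactor0 v p : cf 0 (lfactor v *m p) = pauli (- v) *m cf 0 p.
Proof. by rewrite /lfactor mulmxDl -scalemxAl cfD cfX0 cf_mulC addr0. Qed.

Definition deglt N p := forall m, (N <= m)%N -> cf m p = 0.

Lemma deglt_le N N' p : (N <= N')%N -> deglt N p -> deglt N' p.
Proof. by move=> NN' dp m N'm; apply: dp; exact: leq_trans N'm. Qed.

Lemma deglt_lfactor N v p : deglt N p -> deglt N.+1 (lfactor v *m p).
Proof.
move=> dp [|m] // Nm; rewrite cf_lfactorS (dp m) // (dp m.+1) 1?ltnW //.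
by rewrite !mulmx0 addr0.
Qed.

Lemma deglt_const w : deglt 1 w%:PM.
Proof. by move=> [|m] // _; rewrite cfC. Qed.

Definition dot (a b : 'cV[C]_2) : C := (b^*m *m a) 0 0.

Lemma dotDl a a' b : dot (a + a') b = dot a b + dot a' b.
Proof. by rewrite /dot mulmxDr mxE. Qed.

Lemma dotDr a b b' : dot a (b + b') = dot a b + dot a b'.
Proof. by rewrite /dot raddfD /= map_mxD mulmxDl mxE. Qed.

Lemma dotZl c a b : dot (c *: a) b = c * dot a b.
Proof. by rewrite /dot -scalemxAr mxE. Qed.

Lemma dot0l b : dot 0 b = 0. Proof. by rewrite /dot mulmx0 mxE. Qed.

Lemma dot0r a : dot a 0 = 0. Proof. by rewrite /dot trmx0 map_mx0 mul0mx mxE. Qed.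

Lemma dot_adj (A : 'M[C]_2) a b : dot (A *m a) b = dot a (A^*m *m b).
Proof.
rewrite /dot trmx_mul map_mxM mulmxA; congr ((_ *m _ *m _) _ _).
by apply/matrixP => i j; rewrite !mxE; exact/esym/conjCK.
Qed.

Lemma dot_eq0 a : dot a a = 0 -> a = 0.
Proof.
rewrite /dot mulmx2E !mxE => /eqP; rewrite ![_^* * _]mulrC.
rewrite paddr_eq0 ?mul_conjC_ge0 // !mul_conjC_eq0 => /andP[/eqP a0 /eqP a1].
by apply: col2P; rewrite mxE.
Qed.

Lemma dot_ge0 a : 0 <= dot a a.
Proof.
rewrite /dot mulmx2E !mxE ![_^* * _]mulrC.
by rewrite addr_ge0 ?mul_conjC_ge0.
Qed.

Lemma dot_pauli v a b : unit_vec v ->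
  dot (pauli v *m a) (pauli v *m b) = dot (pauli v *m a) b.
Proof.
by move=> v1; rewrite [in RHS]dot_adj pauli_adj dot_adj pauli_adj mulmxA pauli_idem.
Qed.

Lemma dot_pauliN v a b : unit_vec v -> dot (pauli v *m a) (pauli (- v) *m b) = 0.
Proof.
move=> v1; rewrite dot_adj pauli_adj mulmxA pauli_mulN // mul0mx dot0r //.
Qed.

Lemma dot_pauliN' v a b : unit_vec v -> dot (pauli (- v) *m a) (pauli v *m b) = 0.
Proof. by move=> /unit_vecN v1; rewrite -[in pauli v](opprK v) dot_pauliN. Qed.

Lemma dot_pauli_split v a b : unit_vec v ->
  dot (pauli (- v) *m a) (pauli (- v) *m b) + dot (pauli v *m a) (pauli v *m b)
  = dot a b.
Proof.
move=> v1; rewrite !dot_pauli //; last exact: unit_vecN.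
by rewrite -dotDl -mulmxDl pauliN subrK mul1mx.
Qed.

(** For polynomials of degree below [N] this is the mean over the unit circle of the Hermitian
    product of the values. *)
Definition ip N p q : C := \sum_(m < N) dot (cf m p) (cf m q).

Lemma ip_le N N' p q : (N <= N')%N -> deglt N p -> ip N' p q = ip N p q.
Proof.
move=> NN' dp; rewrite /ip -(subnKC NN') big_split_ord /=.
by rewrite [X in _ + X]big1 ?addr0 // => m _; rewrite dp ?dot0l //= leq_addr.
Qed.

(** The algebraic form of the unitarity of the factor on the circle. *)
Lemma ip_lfactor N v p q : unit_vec v -> deglt N p ->
  ip N.+1 (lfactor v *m p) (lfactor v *m q) = ip N p q.
Proof.
move=> v1 dp.
(* Truncation leaves a boundary term: the part of the coefficients of index [M] that the factor does
   not shift. It vanishes once [M] reaches the degree bound of [p]. *)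
have E M : ip M.+1 (lfactor v *m p) (lfactor v *m q) =
    ip M p q + dot (pauli (- v) *m cf M p) (pauli (- v) *m cf M q).
  elim: M => [|M IH]; first by rewrite /ip big_ord_recl !big_ord0 !cf_lfactor0 addr0 add0r.
  rewrite {1}/ip big_ord_recr /= -/(ip _ _ _) IH {2}/ip big_ord_recr /= -/(ip _ _ _).
  rewrite !cf_lfactorS dotDl !dotDr dot_pauliN // dot_pauliN' //.
  rewrite addr0 add0r -[LHS]addrA -[RHS]addrA; congr (_ + _).
  by rewrite -(dot_pauli_split (cf M p) (cf M q) v1) [RHS]addrAC -[RHS]addrA.
by rewrite E dp // mulmx0 dot0l addr0.
Qed.

Lemma ipDl N p p' q : ip N (p + p') q = ip N p q + ip N p' q.
Proof. by rewrite /ip -big_split; apply: eq_bigr => m _; rewrite cfD dotDl. Qed.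

Lemma ipDr N p q q' : ip N p (q + q') = ip N p q + ip N p q'.
Proof. by rewrite /ip -big_split; apply: eq_bigr => m _; rewrite cfD dotDr. Qed.

Lemma ipZl N (a : C) p q : ip N (a%:P *: p) q = a * ip N p q.
Proof. by rewrite /ip mulr_sumr; apply: eq_bigr => m _; rewrite cfZ dotZl. Qed.

Lemma ip_eq0 N p : deglt N p -> ip N p p = 0 -> p = 0.
Proof.
move=> dp /eqP; rewrite psumr_eq0 => [/allP p0|m _]; last exact: dot_ge0.
apply: cfP => m; rewrite cf0; have [mN|] := ltnP m N; last exact: dp.
have /= := p0 (Ordinal mN); rewrite mem_index_enum => /(_ isT)/eqP.
exact: dot_eq0.
Qed.

Variable x : nat -> 'rV[R]_3.
Hypothesis x1 : forall i, unit_vec (x i).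

Definition Phi m : 'M[{poly C}]_2 := \prod_(0 <= i < m) lfactor (x i).

Lemma Phi0 : Phi 0 = 1%:M. Proof. by rewrite /Phi big_geq. Qed.

Lemma PhiS m : Phi m.+1 = Phi m *m lfactor (x m).
Proof. by rewrite /Phi big_nat_recr. Qed.

Lemma Phi_one m : map_mx (horner_eval 1) (Phi m) = 1%:M.
Proof.
elim: m => [|m IH]; first by rewrite Phi0 map_scalar_mx /= /horner_eval hornerC.
by rewrite PhiS map_mxM IH lfactor_one mulmx1.
Qed.

Lemma deglt_Phi N m p : deglt N p -> deglt (N + m) (Phi m *m p).
Proof.
elim: m N p => [|m IH] N p dp; first by rewrite Phi0 mul1mx addn0.
by rewrite PhiS -mulmxA addnS -addSn; apply: IH; exact: deglt_lfactor.
Qed.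

Lemma ip_Phi N m p q : deglt N p ->
  ip (N + m) (Phi m *m p) (Phi m *m q) = ip N p q.
Proof.
elim: m N p q => [|m IH] N p q dp; first by rewrite Phi0 !mul1mx addn0.
rewrite PhiS -!mulmxA addnS -addSn IH ?ip_lfactor //.
exact: deglt_lfactor.
Qed.

Lemma Phi_split m l : (m <= l)%N -> exists A, Phi l = Phi m *m A.
Proof.
elim: l => [|l IH]; first by rewrite leqn0 => /eqP ->; exists 1%:M; rewrite mulmx1.
rewrite leq_eqVlt => /orP[/eqP ->|/IH[A E]]; first by exists 1%:M; rewrite mulmx1.
by exists (A *m lfactor (x l)); rewrite PhiS E mulmxA.
Qed.

(** [Phi x j] is an isometry and cancels. What remains pairs the constant [w], in the image of the
    projector, with the constant term of a multiple of [lfactor (x j)], in its kernel. *)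
Lemma Phi_orth j l N w q : (j < l)%N -> (j < N)%N -> pauli (x j) *m w = w ->
  ip N (Phi j *m w%:PM) (Phi l *m q) = 0.
Proof.
move=> jl jN wj; have [A ->] := Phi_split jl; rewrite PhiS -!mulmxA.
rewrite -(subnK (ltnW jN)); set r := A *m q; set M := (N - j)%N.
have M0 : (0 < M)%N by rewrite subn_gt0.
rewrite ip_Phi; last exact: deglt_le (deglt_const w).
rewrite (ip_le _ M0 (@deglt_const w)) /ip big_ord1 cfC /= cf_lfactor0.
by rewrite -wj dot_pauliN.
Qed.

(* Multiplication by the remaining factors, up to a power of [t]: it bounds
   the degrees of the basis vectors once [Phi n] is known. *)
Lemma Phi_cancel i m w : exists2 q, deglt m.+1 q &
  Phi (i + m) *m q = 'X^m *: (Phi i *m w%:PM).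
Proof.
elim: m => [|m [q dq E]].
  by exists w%:PM; [exact: deglt_const|rewrite addn0 expr0 scale1r].
exists (lfactor (- x (i + m)) *m q); first exact: deglt_lfactor.
rewrite addnS PhiS -mulmxA [lfactor _ *m (_ *m _)]mulmxA lfactor_mulN //.
by rewrite mul_scalar_mx -scalemxAr E scalerA exprS.
Qed.

End Factors.

(** * The correspondence between flags and factorizations *)

Section TwoStrings.
Context {R : realType} {n : nat} (k : nat).
Hypothesis kn : (k <= n)%N.
Local Notation C := R[i].
Local Notation PV := 'cV[{poly C}]_2.
Local Notation "A ^*m" := (map_mx Num.conj (A^T)) (at level 8).
Local Notation "A %:PM" := (map_mx polyC A) (at level 2).
Implicit Types (p q : PV) (c : 'rV[C]_n) (h : 'M[C]_n).

(* The Jordan basis is identified with the monomials [t^(pos j)] in the component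
   [blk j] of [C[t]^2]; [Gamma] becomes division by [t] dropping constants. *)
Definition blk (j : 'I_n) : 'I_2 := if (j < n - k)%N then 0 else 1.
Definition pos (j : 'I_n) : nat := if (j < n - k)%N then j : nat else (j - (n - k))%N.
Definition blk_size (b : 'I_2) : nat := if b == 0 then (n - k)%N else k.

Lemma pos_lt j : (pos j < blk_size (blk j))%N.
Proof.
have := ltn_ord j; rewrite /pos /blk /blk_size; case: (ltnP j (n - k)) => /=; lia.
Qed.

Lemma blk_size_le b : (blk_size b <= n)%N.
Proof. by rewrite /blk_size; case: ifP => _; lia. Qed.

Lemma blk_pos_inj j j' : blk j = blk j' -> pos j = pos j' -> j = j'.
Proof.
rewrite /blk /pos; case: (ltnP j (n - k)) => ?; case: (ltnP j' (n - k)) => ? //= _ E;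
  apply: val_inj => /=; lia.
Qed.

Lemma blk_pos_surj b m : (m < blk_size b)%N -> exists2 j, blk j = b & pos j = m.
Proof.
rewrite /blk_size; case: (ord2P b) => -> /= mb.
  have mn : (m < n)%N by lia.
  by exists (Ordinal mn); rewrite /blk /pos /= mb.
have mn : (m + (n - k) < n)%N by lia.
by exists (Ordinal mn); rewrite /blk /pos /= ltnNge leq_addl //= addnK.
Qed.

Definition vec_poly (c : 'rV[C]_n) : PV :=
  \sum_j (c 0 j)%:P *: \col_b (if b == blk j then 'X^(pos j) else 0).

Definition poly_vec (p : PV) : 'rV[C]_n := \row_j (p (blk j) 0)`_(pos j).

Lemma cf_vec_poly m c b : cf m (vec_poly c) b 0 =
  \sum_j c 0 j * ((b == blk j) && (m == pos j))%:R.
Proof.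
rewrite mxE summxE /= coef_sum; apply: eq_bigr => j _.
rewrite !mxE coefCM; congr (_ * _).
by case: eqP => _; rewrite ?coefXn ?coef0.
Qed.

Lemma vec_polyK : cancel vec_poly poly_vec.
Proof.
move=> c; apply/rowP => j; rewrite mxE.
have := cf_vec_poly (pos j) c (blk j); rewrite mxE /= => ->.
rewrite (bigD1 j) //= !eqxx mulr1 big1 ?addr0 // => l lj.
rewrite [_ && _](_ : _ = false) ?mulr0 //; apply: contraNF lj => /andP[/eqP B /eqP P].
by apply/eqP/esym/blk_pos_inj.
Qed.

Lemma poly_vecK p : (forall b m, (blk_size b <= m)%N -> (p b 0)`_m = 0) ->
  vec_poly (poly_vec p) = p.
Proof.
move=> p0; apply: cfP => m; apply/matrixP => b j0; rewrite (ord1 j0) cf_vec_poly mxE /=.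
have [mb|bm] := ltnP m (blk_size b).
  have [j B P] := blk_pos_surj mb.
  rewrite (bigD1 j) //= B P !eqxx mulr1 big1 ?addr0 ?mxE ?B ?P // => l lj.
  rewrite [_ && _](_ : _ = false) ?mulr0 //; apply: contraNF lj => /andP[/eqP B' /eqP P'].
  by apply/eqP/blk_pos_inj; [rewrite B|rewrite P].
rewrite p0 // big1 // => j _; rewrite [_ && _](_ : _ = false) ?mulr0 //.
by apply/negP => /andP[/eqP B /eqP P]; move: (pos_lt j); rewrite -B -P ltnNge bm.
Qed.

Lemma vec_polyD c c' : vec_poly (c + c') = vec_poly c + vec_poly c'.
Proof.
by rewrite /vec_poly -big_split; apply: eq_bigr => j _; rewrite mxE polyCD scalerDl.
Qed.

Lemma vec_polyZ a c : vec_poly (a *: c) = a%:P *: vec_poly c.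
Proof.
by rewrite /vec_poly scaler_sumr; apply: eq_bigr => j _; rewrite mxE polyCM scalerA.
Qed.

Lemma vec_poly0 : vec_poly 0 = 0.
Proof. by rewrite /vec_poly big1 // => j _; rewrite mxE polyC0 scale0r. Qed.

Lemma vec_polyB c c' : vec_poly (c - c') = vec_poly c - vec_poly c'.
Proof. by rewrite vec_polyD -scaleN1r vec_polyZ polyCN scaleN1r. Qed.

Lemma vec_poly_mul c h : vec_poly (c *m h) = \sum_i (c 0 i)%:P *: vec_poly (row i h).
Proof.
rewrite mulmx_sum_row (big_morph vec_poly vec_polyD vec_poly0).
by apply: eq_bigr => i _; rewrite vec_polyZ.
Qed.

(** The monomials are orthonormal. Those of [q] outside the two strings are orthogonal to
    [vec_poly c], and [poly_vec] forgets them. *)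
Lemma ip_vec_poly c q : ip n (vec_poly c) q = \sum_j c 0 j * (poly_vec q 0 j)^*.
Proof.
have E m : dot (cf m (vec_poly c)) (cf m q) =
    \sum_j c 0 j * ((m == pos j)%:R * (poly_vec q 0 j)^*).
  rewrite /dot mulmx2E !cf_vec_poly !mulr_sumr -big_split; apply: eq_bigr => j _ /=.
  rewrite !mxE /=; case: (m =P pos j) => [->|_]; last by rewrite !andbF mul0r !mulr0 addr0.
  rewrite !andbT mul1r; case: (ord2P (blk j)) => -> /=;
    by rewrite ?mulr0 ?mulr1 ?addr0 ?add0r mulrC.
rewrite /ip; under eq_bigr do rewrite E.
rewrite exchange_big; apply: eq_bigr => j _; rewrite -mulr_sumr; congr (_ * _).
have pn : (pos j < n)%N := leq_trans (pos_lt j) (blk_size_le _).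
rewrite (bigD1 (Ordinal pn)) //= eqxx mul1r big1 ?addr0 // => m mj.
by rewrite -val_eqE /= in mj; rewrite (negbTE mj) mul0r.
Qed.

Lemma ip_vec_poly2 c c' : ip n (vec_poly c) (vec_poly c') = (c *m c'^*m) 0 0.
Proof. by rewrite ip_vec_poly vec_polyK mxE; apply: eq_bigr => j _; rewrite !mxE. Qed.

(* The matrix of [Gamma] in its Jordan basis. *)
Definition shift_mx : 'M[C]_n := \matrix_(i, j)
  [&& i != 0%N :> nat, i != (n - k)%N :> nat & i == j.+1 :> nat]%:R.

Lemma vec_poly_shift c : vec_poly c = (cf 0 (vec_poly c))%:PM + 'X *: vec_poly (c *m shift_mx).
Proof.
apply: cfP => -[|m]; rewrite cfD cfC /= ?cfX0 ?addr0 // cfXS add0r.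
apply/matrixP => b j0; rewrite (ord1 j0) !cf_vec_poly.
under [RHS]eq_bigr do rewrite mxE mulr_suml.
rewrite exchange_big; apply: eq_bigr => i _ /=.
under eq_bigr do rewrite mxE -mulrA; rewrite -mulr_sumr; congr (_ * _).
have [/andP[i0 ink]|] := boolP ((i != 0%N :> nat) && (i != (n - k)%N :> nat)).
  have pi : (i.-1 < n)%N by rewrite (leq_trans _ (ltn_ord i)) // ltnS leq_pred.
  rewrite (bigD1 (Ordinal pi)) //= prednK ?lt0n // eqxx i0 ink mul1r.
  rewrite big1 ?addr0.
    rewrite /blk /pos /=; congr ((_ && _)%:R).
      by congr (_ == _); rewrite (_ : (i.-1 < _)%N = (i < n - k)%N) //; lia.
    by case: (ltnP i (n - k)); case: (ltnP i.-1 (n - k)) => /=; lia.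
  move=> j; rewrite -val_eqE /= => ji; rewrite (_ : _ == _ = false) ?andbF ?mul0r //; lia.
rewrite negb_and !negbK => i0; rewrite big1 => [|j _]; last first.
  by rewrite andbA -negb_or i0 mul0r.
have -> : pos i = 0%N by rewrite /pos; case/orP: i0 => /eqP ->; case: ltnP; lia.
by rewrite andbF.
Qed.

Lemma shift_mx_trig : is_trig_mx shift_mx.
Proof.
apply/is_trig_mxP => i j ij; rewrite mxE (_ : (i == j.+1 :> nat) = false) ?andbF //.
by apply: ltn_eqF; rewrite ltnS ltnW.
Qed.

Lemma shift_mx_diag i : shift_mx i i = 0.
Proof. by rewrite mxE (_ : (i == i.+1 :> nat) = false) ?andbF //; exact/ltn_eqF/ltnSn. Qed.

End TwoStrings.

(** * Stable flags and products of factors *)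

Section Correspondence.
Context {R : realType}.
Local Notation C := R[i].
Local Notation PV := 'cV[{poly C}]_2.
Local Notation "A ^*m" := (map_mx Num.conj (A^T)) (at level 8).
Local Notation "A %:PM" := (map_mx polyC A) (at level 2).
Variables (x : nat -> 'rV[R]_3) (w : nat -> 'cV[C]_2).
Hypothesis x1 : forall i, unit_vec (x i).
Implicit Types (p q : PV).

Lemma pauli_line v a : unit_vec v -> a != 0 -> pauli v *m a = a ->
  forall c : 'cV[C]_2, exists s, pauli v *m c = s *: a.
Proof.
move=> v1 a0 va c; have [b [u [b0 u0 E]]] := pauli_rank1 v1.
have mulb (d : 'cV[C]_2) : pauli v *m d = (u *m d) 0 0 *: b.
  by rewrite E -mulmxA {1}[u *m d]mx11_scalar mul_mx_scalar.
have ua : (u *m a) 0 0 != 0.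
  by apply: contraNneq a0 => ua; rewrite -va mulb ua scale0r.
exists ((u *m c) 0 0 / (u *m a) 0 0).
by rewrite -[X in _ = _ *: X]va !mulb scalerA divfK.
Qed.

Definition spans_line i := w i != 0 /\ pauli (x i) *m w i = w i.

Definition fvec i : PV := Phi x i *m (w i)%:PM.

(** The space [L_i + Phi_i C^2], with [L_i] spanned by the [fvec l] for [l < i]. *)
Definition in_span i p := exists (s : nat -> C) c,
  p = \sum_(l < i) (s l)%:P *: fvec l + Phi x i *m c%:PM.

Lemma in_span_add i p q : in_span i p -> in_span i q -> in_span i (p + q).
Proof.
move=> [s [c ->]] [s' [c' ->]]; exists (fun l => s l + s' l), (c + c').
rewrite map_mxD mulmxDr addrACA -big_split; congr (_ + _).
by apply: eq_bigr => l _; rewrite polyCD scalerDl.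
Qed.

Lemma in_span_scale i (a : C) p : in_span i p -> in_span i (a%:P *: p).
Proof.
move=> [s [c ->]]; exists (fun l => a * s l), (a *: c).
rewrite scalerDr scaler_sumr map_mxZ -scalemxAr; congr (_ + _).
by apply: eq_bigr => l _; rewrite polyCM scalerA.
Qed.

Lemma in_span0 i : in_span i 0.
Proof.
exists (fun=> 0), 0; rewrite map_mx0 mulmx0 addr0 big1 // => l _.
by rewrite polyC0 scale0r.
Qed.

Lemma in_span_sum i (I : Type) (r : seq I) (P : pred I) (F : I -> PV) :
  (forall j, P j -> in_span i (F j)) -> in_span i (\sum_(j <- r | P j) F j).
Proof. by move=> FP; elim/big_ind : _ => //; [exact: in_span0|exact: in_span_add]. Qed.

Lemma in_span_fvec i l : (l < i)%N -> in_span i (fvec l).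
Proof.
move=> li; exists (fun j => (j == l)%:R), 0; rewrite map_mx0 mulmx0 addr0.
rewrite (bigD1 (Ordinal li)) //= eqxx scale1r big1 ?addr0 // => j.
by rewrite -val_eqE /= => /negbTE ->; rewrite polyC0 scale0r.
Qed.

(** Split [c] along the line of [x l] and its orthogonal complement: the first part gives a multiple
    of [fvec l], while the second is fixed by [lfactor (x l)] and so moves on to [Phi x l.+1].
    Repeating this leads from [j] up to [i]. *)
Lemma in_span_Phi i j c : (j <= i)%N -> (forall l, (l < i)%N -> spans_line l) ->
  in_span i (Phi x j *m c%:PM).
Proof.
move=> ji; rewrite -(subKn ji); elim: (i - j)%N (leq_subr j i) c => [|m IH] mi c gi.
  exists (fun=> 0), c; rewrite subn0 big1 ?add0r // => l _.
  by rewrite polyC0 scale0r.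
have li : (i - m.+1 < i)%N by lia.
set l := (i - m.+1)%N in li *.
have -> : Phi x l *m c%:PM = Phi x l *m (pauli (x l) *m c)%:PM +
    Phi x l.+1 *m (c - pauli (x l) *m c)%:PM.
  rewrite PhiS -mulmxA lfactor_ker ?mulmxBr ?mulmxA ?pauli_idem ?subrr //; last exact: x1.
  by rewrite -mulmxDr -map_mxD addrC subrK.
have [w0 wl] := gi l li.
apply: in_span_add.
  have [s ->] := pauli_line (x1 l) w0 wl c.
  rewrite map_mxZ -scalemxAr; apply: in_span_scale.
  exact: in_span_fvec.
have -> : l.+1 = (i - m)%N by rewrite /l; lia.
apply: IH => //; lia.
Qed.

Lemma fvecX i : spans_line i -> 'X *: fvec i = Phi x i.+1 *m (w i)%:PM.
Proof. by move=> [_ wi]; rewrite PhiS -mulmxA lfactor_im // scalemxAr. Qed.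

Lemma in_span_X i l : (l < i)%N -> (forall l, (l < i)%N -> spans_line l) ->
  in_span i ('X *: fvec l).
Proof. by move=> li gi; rewrite fvecX; [exact: in_span_Phi|exact: gi]. Qed.

Lemma deglt_fvec i N : (i < N)%N -> deglt N (fvec i).
Proof.
move=> iN; apply: (@deglt_le _ (1 + i)); first by rewrite add1n.
exact/deglt_Phi/deglt_const.
Qed.

Lemma degltD N p q : deglt N p -> deglt N q -> deglt N (p + q).
Proof. by move=> dp dq m Nm; rewrite cfD dp // dq // addr0. Qed.

Lemma degltZ N (a : C) p : deglt N p -> deglt N (a%:P *: p).
Proof. by move=> dp m Nm; rewrite cfZ dp // scaler0. Qed.

(** By [Phi_orth] the summand in [Phi_i C^2] is orthogonal to every [fvec l] with [l < i], hence so
    is the other summand [q]. Being a combination of these vectors, [q] is orthogonal to itself. *)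
Lemma in_span_orth i N p : (i <= N)%N -> (forall l, (l < i)%N -> spans_line l) ->
  in_span i p -> (forall l, (l < i)%N -> ip N (fvec l) p = 0) ->
  exists c, p = Phi x i *m c%:PM.
Proof.
move=> iN gi [s [c pE]] p0; exists c; rewrite pE.
set q := \sum_(l < i) _; suff -> : q = 0 by rewrite add0r.
have dq : deglt N q.
  rewrite /q; elim/big_ind : _ => //; first by move=> m _; rewrite cf0.
    by move=> *; exact: degltD.
  by move=> l _; apply/degltZ/deglt_fvec/(leq_trans (ltn_ord l)).
have lq l : (l < i)%N -> ip N (fvec l) q = 0.
  move=> li; have := p0 l li; rewrite pE ipDr /fvec [X in _ + X]Phi_orth ?addr0 //.
    exact: leq_trans iN.
  exact: (gi _ li).2.
apply: (ip_eq0 dq); rewrite {1}/q.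
have : forall r : seq 'I_i, ip N (\sum_(l <- r) (s l)%:P *: fvec l) q = 0.
  elim=> [|l r IH].
    by rewrite big_nil /ip big1 // => m _; rewrite cf0 dot0l.
  by rewrite big_cons ipDl IH ipZl lq // mulr0 addr0.
exact.
Qed.

Variables (n k : nat).
Hypothesis kn : (k <= n)%N.

Definition diag_powers : 'M[{poly C}]_2 :=
  \matrix_(a, b) if a == b then 'X^(@blk_size n k a) else 0.

Section FlagToSpheres.
Variables (h L : 'M[C]_n).
Hypothesis hu : h \in unitmx.
Hypothesis h_orth : forall i j, i != j -> (h *m h^*m) i j = 0.
Hypothesis hZ : h *m shift_mx k = L *m h.
Hypothesis L_lower : forall i j : 'I_n, (i <= j)%N -> L i j = 0.
Hypothesis wE : forall i : 'I_n, w i = map_mx (horner_eval 1) (vec_poly k (row i h)).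
Hypothesis wx : forall i : 'I_n, w i != 0 -> pauli (x i) *m w i = w i.

Lemma row_orth (i j : 'I_n) : i != j -> ip n (vec_poly k (row i h)) (vec_poly k (row j h)) = 0.
Proof.
move=> ij; rewrite ip_vec_poly2 // -(h_orth ij) !mxE.
by apply: eq_bigr => l _; rewrite !mxE.
Qed.

Lemma horner_Phi i (c : 'cV[C]_2) :
  map_mx (horner_eval 1) (Phi x i *m c%:PM) = c.
Proof.
rewrite map_mxM Phi_one mul1mx; apply/matrixP => a b.
by rewrite !mxE; exact: hornerC.
Qed.

(* By induction the row [h_i] lies in [L_i + Phi_i C^2], because [Gamma h_i] lies
   in [L_i]; orthogonality then leaves only the second summand. *)
Lemma springer_step (i : 'I_n) : spans_line i /\ vec_poly k (row i h) = fvec i.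
Proof.
suff: forall m, forall i : 'I_n, (i < m)%N -> spans_line i /\ vec_poly k (row i h) = fvec i.
  by move/(_ i.+1 i (ltnSn i)).
elim=> // m IH {}i; rewrite ltnS => im.
have {IH}IH (l : 'I_n) : (l < i)%N -> spans_line l /\ vec_poly k (row l h) = fvec l.
  by move=> li; apply: IH; exact: leq_trans im.
have gi l : (l < i)%N -> spans_line l.
  by move=> li; have [] := IH (Ordinal (ltn_trans li (ltn_ord i))) li.
have S : in_span i (vec_poly k (row i h)).
  rewrite vec_poly_shift //; apply: in_span_add.
    by have := @in_span_Phi i 0 (cf 0 (vec_poly k (row i h))) isT gi; rewrite Phi0 mul1mx.
  have -> : row i h *m shift_mx k = row i L *m h by rewrite -!row_mul hZ.
  rewrite vec_poly_mul scaler_sumr; apply: in_span_sum => l _.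
  rewrite scalerA mulrC -scalerA; have [il|li] := leqP i l.
    by rewrite mxE L_lower // polyC0 scale0r; exact: in_span0.
  by apply: in_span_scale; rewrite (IH l li).2; exact: in_span_X.
have [c E] : exists c, vec_poly k (row i h) = Phi x i *m c%:PM.
  apply: (@in_span_orth i n) => //; first exact: ltnW.
  move=> l li; pose l' := Ordinal (ltn_trans li (ltn_ord i)).
  have <- := (IH l' li).2; apply: row_orth.
  by rewrite -val_eqE /= ltn_eqF.
have wc : w i = c by rewrite wE E horner_Phi.
have w0 : w i != 0.
  apply/negP => /eqP w0; move: E; rewrite -wc w0 map_mx0 mulmx0 => /(congr1 (@poly_vec R n k)).
  rewrite vec_polyK // => ri0.
  have : delta_mx 0 i *m h = 0 :> 'rV_n.
    by rewrite -rowE ri0; apply/rowP => j; rewrite !mxE coef0.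
  move/(congr1 (mulmx^~ (invmx h))); rewrite mulmxK // mul0mx.
  by move/rowP/(_ i); rewrite !mxE !eqxx => /eqP; rewrite oner_eq0.
by split; [split=> //; exact: wx|rewrite E -wc].
Qed.

(** In each component [b], the first monomial outside [C^n] is orthogonal to [L_n], which is all of
    [C^n], and lies in [t L_n + C^2]. So it equals [Phi x n] applied to a constant, which evaluation
    at [t = 1] identifies as the basis vector. *)
Lemma springer_Phi : Phi x n = diag_powers.
Proof.
have gn l : (l < n)%N -> spans_line l by move=> ln; exact: (springer_step (Ordinal ln)).1.
have fE l (ln : (l < n)%N) : fvec l = vec_poly k (row (Ordinal ln) h).
  by rewrite (springer_step _).2.
suff H : forall b : 'I_2, Phi x n *m (delta_mx b 0 : 'cV[C]_2)%:PM =
    'X^(@blk_size n k b) *: (delta_mx b 0 : 'cV[C]_2)%:PM.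
  apply/matrixP => a b; have /matrixP/(_ a 0) := H b.
  rewrite map_delta_mx -colE !mxE => ->; rewrite eqxx andbT.
  by case: eqP => [->|_]; rewrite ?mulr1 ?mulr0.
move=> b; set d := @blk_size n k b; set q := 'X^d *: _.
have S : in_span n q.
  (* An empty string, as for [k = 0], makes the monomial a constant; otherwise it is [t] times a
     basis vector of [C^n], expanded in the rows of [h]. *)
  rewrite /q; case E : d => [|m].
    rewrite expr0 scale1r -[X in in_span _ X]mul1mx -(Phi0 x).
    exact: in_span_Phi.
  have md : (m < @blk_size n k b)%N by rewrite -/d E.
  have [j jb jm] := blk_pos_surj kn md.
  have -> : ('X^(m.+1) : {poly C}) *: (delta_mx b 0 : 'cV[C]_2)%:PM =
      'X *: vec_poly k (delta_mx 0 j : 'rV[C]_n).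
    rewrite exprS -scalerA; congr (_ *: _); apply: cfP => l; apply/matrixP => a j0.
    rewrite (ord1 j0) cf_vec_poly (bigD1 j) //= !mxE !eqxx mul1r big1 ?addr0.
      rewrite /= jb jm andbT.
      by case: (a =P b); rewrite ?polyC1 ?polyC0 ?mulr1 ?mulr0 ?coefXn ?coef0.
    by move=> i ij; rewrite mxE eqxx (negbTE ij) mul0r.
  have -> : delta_mx 0 j = row j (invmx h) *m h by rewrite -row_mul mulVmx // row1.
  rewrite vec_poly_mul scaler_sumr; apply: in_span_sum => l _.
  rewrite scalerA mulrC -scalerA; apply: in_span_scale.
  by rewrite (springer_step l).2; exact: in_span_X.
have [c E] : exists c, q = Phi x n *m c%:PM.
  apply: (@in_span_orth n n) => // l ln; rewrite fE ip_vec_poly // big1 // => j _.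
  rewrite [poly_vec _ _ _ _]mxE /q map_delta_mx !mxE andbT.
  have := @pos_lt n k kn j; case: (blk k j =P b) => [->|_ _].
    by rewrite mulr1 coefXn => /ltn_eqF ->; rewrite conjC0 mulr0.
  by rewrite mulr0 coef0 conjC0 mulr0.
suff -> : delta_mx b 0 = c by [].
rewrite -(horner_Phi n c) -E; apply/matrixP => a j.
by rewrite /q map_delta_mx !mxE /horner_eval !hornerE expr1n mul1r;
  case: (_ && _); rewrite !hornerE.
Qed.

End FlagToSpheres.

Section SpheresToFlag.
Hypothesis w_spans : forall i, (i < n)%N -> spans_line i.
Hypothesis PhiD : Phi x n = diag_powers.

Definition fvec_mx : 'M[C]_n := \matrix_i poly_vec k (fvec i).

(** This is a degree bound in each component. [Phi_cancel] gives
    [Phi x n *m q = 'X^(n - i) *: fvec i] with [q] of degree below [n - i]; as [Phi x n] is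
    diagonal, component [b] of [fvec i] has degree below [blk_size b]. *)
Lemma fvec_mxE (i : 'I_n) : vec_poly k (row i fvec_mx) = fvec i.
Proof.
rewrite rowK poly_vecK // => b m bm.
have iE : (i.+1 + (n - i.+1))%N = n by have := ltn_ord i; lia.
have [q dq] := Phi_cancel x1 i.+1 (n - i.+1) (w i).
rewrite iE PhiD -fvecX; last exact: w_spans.
rewrite scalerA -exprSr => /matrixP/(_ b 0); rewrite !mxE (bigD1 b) //=.
rewrite mxE eqxx big1 ?addr0 => [E|l lb]; last first.
  by rewrite mxE eq_sym (negbTE lb) mul0r.
set e := (n - i.+1).+1 in dq E.
have := congr1 (fun r : {poly C} => r`_(m + e)) E.
rewrite /= coefXnM [RHS]coefXnM addnK -[RHS]/(if (m + e < e)%N then _ else _).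
rewrite [in RHS]ltnNge leq_addl /= => <-; case: ltnP => // _.
have -> : (m + e - @blk_size n k b = (m - @blk_size n k b) + e)%N by lia.
have /matrixP/(_ b 0) := dq ((m - @blk_size n k b) + e)%N (leq_addl _ _).
by rewrite !mxE.
Qed.

(** Each factor differs from the identity by [t - 1] times a projector, and the differences of
    consecutive products add up. *)
Lemma Phi_telescope i (c : 'cV[C]_2) : Phi x i *m c%:PM =
  c%:PM + ('X - 1) *: \sum_(j < i) Phi x j *m (pauli (x j) *m c)%:PM.
Proof.
elim: i => [|i IH]; first by rewrite Phi0 mul1mx big_ord0 scaler0 addr0.
rewrite PhiS lfactorE mulmxDr mulmx1 mulmxDl IH big_ord_recr scalerDr addrA.
by rewrite -scalemxAr -scalemxAl -mulmxA -map_mxM.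
Qed.

Lemma fvec_mx_orth (i j : 'I_n) : i != j -> (fvec_mx *m fvec_mx^*m) i j = 0.
Proof.
have H (a b : 'I_n) : (a < b)%N -> ip n (fvec a) (fvec b) = 0.
  by move=> ab; apply: Phi_orth => //; exact: (w_spans (ltn_ord a)).2.
have E (a b : 'I_n) : (fvec_mx *m fvec_mx^*m) a b = ip n (fvec a) (fvec b).
  rewrite -!fvec_mxE ip_vec_poly2 // !mxE.
  by apply: eq_bigr => l _; rewrite !mxE.
rewrite -val_eqE neq_ltn => /orP[ij|ji]; first by rewrite E H.
have : (fvec_mx *m fvec_mx^*m) j i = 0 by rewrite E H.
move/(congr1 Num.conj); rewrite conjC0 => <-; rewrite !mxE rmorph_sum.
apply: eq_bigr => l _; rewrite !mxE rmorphM mulrC; congr (_ * _).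
exact/esym/conjCK.
Qed.

Lemma fvec_neq0 (i : 'I_n) : fvec i != 0.
Proof.
have [w0 _] := w_spans (ltn_ord i); apply: contraNneq w0 => f0.
by rewrite -(horner_Phi i (w i)) -/(fvec i) f0; apply/eqP/matrixP => a b;
  rewrite !mxE; exact: horner0.
Qed.

Lemma fvec_mx_unit : fvec_mx \in unitmx.
Proof.
apply: unitmx_ker => c c0; apply/rowP => i; rewrite mxE.
have : (c *m (fvec_mx *m fvec_mx^*m)) 0 i = 0 by rewrite mulmxA c0 mul0mx mxE.
rewrite mxE (bigD1 i) //= big1 ?addr0; last first.
  by move=> j ji; rewrite fvec_mx_orth ?mulr0.
move/eqP; rewrite mulf_eq0 => /orP[/eqP //|/eqP E].
suff : fvec i = 0 by move/eqP; rewrite (negbTE (fvec_neq0 i)).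
have di : deglt n (fvec i) by exact: deglt_fvec.
apply: (ip_eq0 di); rewrite -fvec_mxE ip_vec_poly2 // -{}E !mxE.
by apply: eq_bigr => l _; rewrite !mxE.
Qed.

(** By [Phi_telescope], [u_i = w_i + (t - 1) s] with [s] in [L_i]. The shift kills [w_i] and takes
    [t s] back to [s], so it sends [u_i] to [s] minus the shift of [s], which lies in [L_i] by
    strong induction. *)
Lemma fvec_mx_shift : exists2 L : 'M[C]_n, is_trig_mx L &
  fvec_mx *m shift_mx k = L *m fvec_mx.
Proof.
suff /choice[L LP] (i : 'I_n) : exists l : 'rV[C]_n,
    (forall j : 'I_n, (i < j)%N -> l 0 j = 0) /\
    row i fvec_mx *m shift_mx k = l *m fvec_mx.
  exists (\matrix_i L i).
    by apply/is_trig_mxP => i j ij; rewrite mxE; exact: (LP i).1.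
  by apply/row_matrixP => i; rewrite row_mul (LP i).2 row_mul rowK.
suff: forall m, forall i : 'I_n, (i < m)%N -> exists l : 'rV[C]_n,
    (forall j : 'I_n, (i < j)%N -> l 0 j = 0) /\
    row i fvec_mx *m shift_mx k = l *m fvec_mx.
  by move/(_ i.+1 i (ltnSn i)).
elim=> // m IH {}i; rewrite ltnS => im.
have /choice[b bP] (j : 'I_n) : exists b, pauli (x j) *m w i = b *: w j.
  by have [w0 wj] := w_spans (ltn_ord j); exact: pauli_line.
pose s : 'rV[C]_n := \row_j if (j < i)%N then b j else 0.
have sE : vec_poly k (s *m fvec_mx) =
    \sum_(j < i) Phi x j *m (pauli (x j) *m w i)%:PM.
  rewrite vec_poly_mul (big_ord_widen n
    (fun j => Phi x j *m (pauli (x j) *m w i)%:PM)); last exact: ltnW.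
  rewrite [RHS]big_mkcond; apply: eq_bigr => j _; rewrite fvec_mxE mxE.
  case: ifP => _; last by rewrite polyC0 scale0r.
  by rewrite bP map_mxZ -scalemxAr.
have Z : row i fvec_mx *m shift_mx k = s *m fvec_mx - s *m fvec_mx *m shift_mx k.
  apply: (can_inj (vec_polyK kn)); apply: cfP => l; rewrite vec_polyB.
  have shiftE (c : 'rV[C]_n) : cf l (vec_poly k (c *m shift_mx k)) = cf l.+1 (vec_poly k c).
    by rewrite [in RHS](vec_poly_shift kn) cfD cfXS (cfC l.+1 (cf 0 _)) add0r.
  rewrite shiftE fvec_mxE /fvec Phi_telescope -sE [LHS]cfD.
  rewrite (cfC l.+1 (w i)) add0r.
  rewrite scalerBl scale1r.
  by rewrite !cfB cfXS shiftE.
have /choice[t tP] (j : 'I_n) : exists l : 'rV[C]_n, (j < i)%N ->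
    (forall j' : 'I_n, (j < j')%N -> l 0 j' = 0) /\
    row j fvec_mx *m shift_mx k = l *m fvec_mx.
  have [ji|] := ltnP j i; last by exists 0.
  by have [l lP] := IH j (leq_trans ji im); exists l.
exists (s - \sum_(j < n | (j < i)%N) b j *: t j); split.
  move=> j ij; rewrite !mxE ltnNge (ltnW ij) /= summxE big1 ?subr0 // => l li.
  by rewrite mxE (tP l li).1 ?mulr0 //; exact: ltn_trans ij.
rewrite Z mulmxBl; congr (_ - _).
rewrite mulmx_suml -mulmxA mulmx_sum_row [RHS]big_mkcond; apply: eq_bigr => j _.
rewrite mxE; case: ifP => ji; last by rewrite scale0r.
by rewrite row_mul (tP j ji).2 scalemxAl.
Qed.

End SpheresToFlag.

End Correspondence.

(** * Factorizations and noncrossing matchings *)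

Section Matchings.
Context {n : nat}.
Implicit Types (s : seq 'I_n) (A : {set 'I_n * 'I_n}) (B : {set 'I_n}).

(** The pattern of the vertices left after deleting pairs of neighbours. Alternating parity makes
    the signs in [turn] opposite for neighbours, however distant they were originally. *)
Definition alternating : rel 'I_n := fun i j => (i < j)%N && (odd i != odd j).

Definition incident A (v : 'I_n) := #|[set e in A | (v == e.1) || (v == e.2)]|.

(* [noncrossing_matching] relative to a subset of the vertices, so that
   removing an arc needs no renumbering. *)
Definition matching_on s m r A B :=
  [/\ #|A| = m /\ #|B| = r,
      forall e, e \in A -> (e.1 < e.2)%N,
      forall v : 'I_n, (incident A v + (v \in B))%N = (v \in s),
      forall e f, e \in A -> f \in A ->
        ~~ [&& e.1 < f.1, f.1 < e.2 & e.2 < f.2]%N &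
      forall e v, e \in A -> v \in B -> ~~ (e.1 < v < e.2)%N].

Lemma incidentD1 A e v : e \in A ->
  incident A v = (((v == e.1) || (v == e.2)) + incident (A :\ e) v)%N.
Proof.
move=> eA; rewrite /incident (cardsD1 e) inE eA /=; congr (_ + _)%N.
by apply: eq_card => f; rewrite !inE; case: eqP; rewrite ?andbF.
Qed.

Lemma incident_gt0 A e v : e \in A -> (v == e.1) || (v == e.2) ->
  (0 < incident A v)%N.
Proof. by move=> eA ve; rewrite (incidentD1 _ eA) ve. Qed.

Lemma matching_on_mem s m r A B e : matching_on s m r A B -> e \in A ->
  e.1 \in s /\ e.2 \in s.
Proof.
move=> [_ _ deg _ _] eA.
have H v : (v == e.1) || (v == e.2) -> v \in s.
  move=> ve; have := deg v; have := incident_gt0 eA ve; case: (v \in s) => //=; lia.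
by split; apply: H; rewrite eqxx ?orbT.
Qed.

Lemma alternating_lt s : sorted alternating s -> sorted (fun i j : 'I_n => (i < j)%N) s.
Proof. by apply: sub_sorted => i j /andP[]. Qed.

Lemma alternating_pairwise s : sorted alternating s ->
  pairwise (fun i j : 'I_n => (i < j)%N) s.
Proof.
move/alternating_lt; rewrite sorted_pairwise // => i j l; exact: ltn_trans.
Qed.

Lemma alternating_uniq s : sorted alternating s -> uniq s.
Proof.
move/alternating_lt; apply: sorted_uniq => [i j l|i]; [exact: ltn_trans|exact: ltnn].
Qed.

Lemma alternating_remove s1 i j s2 :
  sorted alternating (s1 ++ [:: i, j & s2]) -> sorted alternating (s1 ++ s2).
Proof.
case: s1 => [|z s1] /=.
  by case/andP => _ /path_sorted.
rewrite !cat_path /= => /and4P[-> /andP[li pi] /andP[ij pj]] /=.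
case: s2 => //= l s2 /andP[/andP[jl pl] ->]; rewrite andbT /alternating.
apply/andP; split; first lia.
by move: pi pj pl; case: (odd _); case: (odd i); case: (odd j); case: (odd l).
Qed.

Lemma alternating_between s1 i j s2 v : sorted alternating (s1 ++ [:: i, j & s2]) ->
  v \in s1 ++ s2 -> ~~ (i < v < j)%N.
Proof.
move/alternating_pairwise; rewrite pairwise_cat !allrel_consr /=.
move=> /and3P[/and3P[/allP a1 _ _] _].
move=> /and3P[_ /allP a2 _]; rewrite mem_cat => /orP[/a1|/a2]; lia.
Qed.

Lemma alternating_notin s1 i j s2 : sorted alternating (s1 ++ [:: i, j & s2]) ->
  [/\ i != j, i \notin s1 ++ s2 & j \notin s1 ++ s2].
Proof.
move/alternating_uniq; rewrite -[[:: i, j & s2]]/([:: i; j] ++ s2) uniq_catCA /=.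
by rewrite inE negb_or => /and3P[/andP[-> ->] ->].
Qed.

Lemma adjacent_split s (i j : 'I_n) : sorted alternating s -> i \in s -> j \in s ->
  (i < j)%N -> (forall v, v \in s -> ~~ (i < v < j)%N) ->
  exists s1 s2, s = s1 ++ [:: i, j & s2].
Proof.
move=> ss /splitPr iS; case: iS ss => p1 p2 ss jS ij nb; exists p1.
have := alternating_pairwise ss; rewrite pairwise_cat allrel_consr /=.
move=> /and3P[/andP[/allP a1 _] _ /andP[/allP a2 pw]].
have jp2 : j \in p2.
  move: jS; rewrite mem_cat inE => /or3P[/a1||//]; first lia.
  by move/eqP => E; move: ij; rewrite E ltnn.
case: p2 jp2 a2 pw nb {ss jS} => // z p2; rewrite inE => /orP[/eqP <-|jp2] a2 pw nb.
  by exists p2.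
have iz : (i < z)%N by apply: a2; rewrite mem_head.
have zj : (z < j)%N by move: pw => /= /andP[/allP/(_ j jp2)].
by have := nb z; rewrite mem_cat !inE eqxx !orbT iz zj => /(_ isT).
Qed.

(** A shortest arc has no vertex of [s] under it: a ray is forbidden there, and an arc ending there
    would be trapped below by noncrossing and be shorter. So its endpoints are neighbours in [s] and
    can be removed. *)
Lemma matching_on_split s m r A B : sorted alternating s -> matching_on s m.+1 r A B ->
  exists s1 i j s2, [/\ s = s1 ++ [:: i, j & s2], (i, j) \in A &
    matching_on (s1 ++ s2) m r (A :\ (i, j)) B].
Proof.
move=> ss M; have [[cA cB] lt deg nc nr] := M.
have /card_gt0P[e0 e0A] : (0 < #|A|)%N by rewrite cA.
have [e eA emin] := @arg_minnP _ e0 (fun e => e \in A) (fun e => (e.2 - e.1)%N) e0A.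
have [e1s e2s] := matching_on_mem M eA; have e12 := lt e eA.
have nb v : v \in s -> ~~ (e.1 < v < e.2)%N.
  move=> vs; apply/negP => /andP[v1 v2].
  have := deg v; rewrite vs; case: (boolP (v \in B)) => [vB _|_ dv].
    by have := nr e v eA vB; rewrite v1 v2.
  have /card_gt0P[f] : (0 < incident A v)%N.
    by move: dv; rewrite addn0 => ->.
  rewrite inE => /andP[fA fv]; have f12 := lt f fA; have fmin := emin f fA.
  have nc1 := nc e f eA fA; have nc2 := nc f e fA eA.
  have fe : f != e.
    apply/negP => /eqP E; move: fv; rewrite E => /orP[] /eqP Ev;
      by move: v1 v2; rewrite Ev ltnn.
  (* Noncrossing only excludes strict interleaving; common endpoints are excluded by the degree
     condition. *)
  have share u : (u == e.1) || (u == e.2) -> (u == f.1) || (u == f.2) -> False.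
    move=> ue uf; have := deg u; rewrite (incidentD1 _ eA) ue.
    have fA' : f \in A :\ e by rewrite !inE fe.
    have := incident_gt0 fA' uf; case: (u \in s); rewrite /=;
      move: (incident _ _) (nat_of_bool (u \in B)) => p q; clear; lia.
  case/orP: fv => /eqP Ev; subst v.
    have : f.2 != e.2.
      by apply/eqP => E; apply: (share e.2); rewrite ?eqxx ?E ?eqxx ?orbT.
    rewrite -val_eqE /=; lia.
  have : f.1 != e.1.
    by apply/eqP => E; apply: (share e.1); rewrite ?eqxx ?E ?eqxx ?orbT.
  rewrite -val_eqE /=; lia.
have [s1 [s2 sE]] := adjacent_split ss e1s e2s e12 nb.
have eE : (e.1, e.2) = e by rewrite -surjective_pairing.
exists s1, e.1, e.2, s2; rewrite eE; split=> //; split.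
- by move: cA; rewrite (cardsD1 e) eA => -[].
- by move=> f; rewrite inE => /andP[_ /lt].
- move=> v; have := deg v; rewrite (incidentD1 _ eA) sE.
  have [] := alternating_notin (s1 := s1) (i := e.1) (j := e.2) (s2 := s2);
    first by rewrite -sE.
  move=> ne n1 n2; move: n1 n2; rewrite !mem_cat !inE.
  case: (v =P e.1) => [->|_].
    by rewrite (negbTE ne) orbT => /negbTE -> _ [->].
  case: (v =P e.2) => [->|_] /=; last by rewrite add0n.
  by rewrite orbT => _ /negbTE -> [->].
- by move=> f g; rewrite !inE => /andP[_ fA] /andP[_ gA]; exact: nc.
- by move=> f v; rewrite inE => /andP[_ fA]; exact: nr.
Qed.

(** No other vertex of the sequence lies between the two neighbours, so the new arc can cross
    neither an arc nor a ray. *)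
Lemma matching_on_add s1 i j s2 m r A B : sorted alternating (s1 ++ [:: i, j & s2]) ->
  matching_on (s1 ++ s2) m r A B ->
  matching_on (s1 ++ [:: i, j & s2]) m.+1 r ((i, j) |: A) B.
Proof.
move=> ss M; have [[cA cB] lt deg nc nr] := M.
have ij : (i < j)%N.
  by have := alternating_pairwise ss; rewrite pairwise_cat /= => /and5P[_ _ /andP[]].
have [nij i1 j1] := alternating_notin ss.
have eA : (i, j) \notin A by apply: contra i1 => /(matching_on_mem M)[].
split.
- by rewrite cardsU1 eA cA cB.
- by move=> e; rewrite !inE => /orP[/eqP ->|/lt].
- move=> v; rewrite (@incidentD1 _ (i, j)) ?setU11 // setU1K //= -addnA deg.
  rewrite !mem_cat !inE.
  move: i1 j1; rewrite !mem_cat !negb_or => /andP[i1 i2] /andP[j1 j2].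
  case: (v =P i) => [->|_].
    by rewrite (negbTE i1) (negbTE i2) (negbTE nij).
  case: (v =P j) => [->|_]; first by rewrite (negbTE j1) (negbTE j2).
  by rewrite add0n.
- move=> e f; rewrite !inE => /orP[/eqP ->|eA'] /orP[/eqP ->|fA'] /=; first by lia.
  + have [f1 _] := matching_on_mem M fA'.
    by apply: contra (alternating_between ss f1) => /and3P[-> -> _].
  + have [_ e2] := matching_on_mem M eA'.
    by apply: contra (alternating_between ss e2) => /and3P[_ -> ->].
  + exact: nc.
- move=> e v; rewrite !inE => /orP[/eqP ->|eA'] vB; last exact: nr.
  have vs : v \in s1 ++ s2 by have := deg v; rewrite vB; case: (v \in _) => //; lia.
  exact: alternating_between ss vs.
Qed.

End Matchings.

(** * Cancelling antipodal neighbours in a product of factors *)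

Section MatchingProducts.
Context {R : realType} {n : nat}.
Local Notation C := R[i].
Variable y : 'I_n -> 'rV[R]_3.
Hypothesis y1 : forall i, unit_vec (y i).
Implicit Types (s : seq 'I_n).

(* The sign turns the equalities [y i = y j] along arcs into antipodality. *)
Definition turn (i : 'I_n) : 'rV[R]_3 := (-1) ^+ i.+1 *: y i.

Definition diagp a b : 'M[{poly C}]_2 :=
  \matrix_(i, j) if i == j then 'X^(if i == 0 then a else b) else 0.

Lemma diagp_mul a b a' b' : diagp a b *m diagp a' b' = diagp (a + a') (b + b').
Proof.
by apply: matrix2P; rewrite mulmx2E !mxE /= ?mulr0 ?mul0r ?addr0 ?add0r ?exprD.
Qed.

Lemma diagp_scalar a : diagp a a = ('X^a)%:M.
Proof. by apply: matrix2P; rewrite !mxE. Qed.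

Lemma north_unit : unit_vec (north R).
Proof. by rewrite /unit_vec sum3E !mxE /= !expr0n expr1n !add0r. Qed.

Lemma lfactor_north : lfactor (north R) = diagp 1 0.
Proof.
have n0 : north R 0 0 = 0 by rewrite mxE.
have n1 : north R 0 1 = 0 by rewrite mxE.
have n2 : north R 0 ord_max = 1 by rewrite mxE.
have P : pauli (north R) = delta_mx 0 0.
  by apply: matrix2P; rewrite pauliE ?n0 ?n1 ?n2 mxE; apply: complexP => /=; lra.
have N : pauli (- north R) = delta_mx 1 1.
  rewrite pauliN P; apply: matrix2P; rewrite !mxE /=; ring.
apply: matrix2P; rewrite /lfactor P N !map_delta_mx !mxE /= ?mulr0 ?mulr1 ?addr0 ?add0r //.
Qed.

Lemma turn_unit i : unit_vec (turn i).
Proof.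
rewrite /unit_vec -(y1 i); apply: eq_bigr => j _.
by rewrite !mxE exprMn sqrr_sign mul1r.
Qed.

Lemma turn_alt i j : alternating i j -> turn j = - turn i <-> y i = y j.
Proof.
move=> /andP[_ p]; have E : (-1) ^+ j.+1 = - (-1) ^+ i.+1 :> R.
  rewrite -signr_odd -[in RHS]signr_odd /=.
  by move: p; case: (odd i); case: (odd j) => //= _; rewrite ?expr0 ?expr1 ?opprK.
rewrite /turn E scaleNr; split=> [/oppr_inj/(congr1 ( *:%R ((-1) ^+ i.+1)))|->//].
by rewrite !scalerA -expr2 sqrr_sign !scale1r.
Qed.

Lemma turn_north i : turn i = north R <-> y i = (-1) ^+ i.+1 *: north R.
Proof.
by split=> [<-|E]; rewrite /turn ?E scalerA -expr2 sqrr_sign scale1r.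
Qed.

Definition turn_prod s : 'M[{poly C}]_2 := \prod_(i <- s) lfactor (turn i).

Lemma turn_prod_cons i s : turn_prod (i :: s) = lfactor (turn i) *m turn_prod s.
Proof. by rewrite /turn_prod big_cons. Qed.

Lemma turn_prod_remove s1 i j s2 : turn j = - turn i ->
  turn_prod (s1 ++ [:: i, j & s2]) = 'X *: turn_prod (s1 ++ s2).
Proof.
move=> E; rewrite /turn_prod !big_cat !big_cons /= -!mulmxE E.
rewrite [lfactor _ *m (_ *m _)]mulmxA lfactor_mulN; last exact: turn_unit.
by rewrite mul_scalar_mx scalemxAr.
Qed.

Lemma scaleX_inj : injective (fun A : 'M[{poly C}]_2 => 'X *: A).
Proof.
move=> A B /matrixP E; apply/matrixP => i j; have := E i j; rewrite !mxE.
by apply: mulfI; rewrite polyX_eq0.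
Qed.

Lemma diagpS a b : diagp a.+1 b.+1 = 'X *: diagp a b.
Proof.
by apply: matrix2P; rewrite !mxE /= ?mulr0 ?exprS.
Qed.

(** Removing an innermost arc divides the product by [t]. Without arcs every vertex of [s] carries a
    ray, and each factor is [diagp 1 0]. *)
Lemma turn_prod_matching s m r A B : sorted alternating s -> matching_on s m r A B ->
  (forall i j, (i, j) \in A -> y i = y j) ->
  (forall i, i \in B -> y i = (-1) ^+ i.+1 *: north R) ->
  turn_prod s = diagp (r + m) m.
Proof.
elim: m s A => [|m IH] s A ss M yA yB.
  have [[/cards0_eq A0 cB] _ deg _ _] := M.
  have sB : B =i s.
    move=> v; have := deg v; rewrite /incident A0.
    rewrite (_ : [set e in finset.set0 | _] = finset.set0); last first.
      by apply/finset.setP => e; rewrite !inE.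
    by rewrite cards0 add0n; case: (v \in B); case: (v \in s).
  rewrite addn0 -cB (eq_card sB) (card_uniqP (alternating_uniq ss)).
  have {}yB i : i \in s -> turn i = north R.
    by rewrite -sB => /yB/turn_north.
  elim: (s) yB => [|i t IHt] yB.
    by rewrite /turn_prod big_nil diagp_scalar expr0.
  rewrite turn_prod_cons yB ?mem_head // IHt => [|j jt]; last by rewrite yB // inE jt orbT.
  by rewrite lfactor_north diagp_mul.
have [s1 [i [j [s2 [sE ijA M']]]]] := matching_on_split ss M.
have aij : alternating i j.
  by move: ss; rewrite sE; case: (s1) => [|z t] /=; rewrite ?cat_path /=;
    [case/andP|case/and4P].
rewrite sE turn_prod_remove; last by apply/(turn_alt aij)/yA.
rewrite (IH _ (A :\ (i, j))) //; last first.
- by move=> a b; rewrite inE => /andP[_ /yA].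
- by rewrite sE in ss; exact: alternating_remove ss.
by rewrite addnS diagpS.
Qed.

(** The middle projector has rank one, so the triple product is a nonzero column times a nonzero
    row. *)
Lemma pauli_mul_neq0 v (A B : 'M[C]_2) : unit_vec v ->
  A *m pauli v != 0 -> pauli v *m B != 0 -> A *m pauli v *m B != 0.
Proof.
move=> v1; have [a [b [a0 b0 ->]]] := pauli_rank1 v1; rewrite mulmxA => Aa bB.
have {Aa}/matrix0Pn[i [i0 Aai]] : A *m a != 0 by apply: contraNneq Aa => ->; rewrite mul0mx.
have {bB}/matrix0Pn[j0 [j bBj]] : b *m B != 0.
  by apply: contraNneq bB => E; rewrite -mulmxA E mulmx0.
apply/matrix0Pn; exists i, j; rewrite -mulmxA mxE big_ord1.
by rewrite (ord1 i0) in Aai; rewrite (ord1 j0) in bBj; rewrite mulf_neq0.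
Qed.

Definition qprod s : 'M[C]_2 := \prod_(i <- s) pauli (- turn i).

Lemma turn_prod_horner0 s : map_mx (horner_eval 0) (turn_prod s) = qprod s.
Proof.
elim: s => [|i s IH].
  rewrite /turn_prod /qprod !big_nil; apply/matrixP => a b; rewrite !mxE.
  by case: (a == b); rewrite /horner_eval !hornerE.
rewrite turn_prod_cons map_mxM IH /qprod big_cons -mulmxE; congr (_ *m _).
apply/matrixP => a b.
transitivity (((pauli (- turn i) a b)%:P + 'X * (pauli (turn i) a b)%:P).[0]).
  by rewrite !mxE.
by rewrite hornerD hornerM hornerX mul0r addr0 hornerC.
Qed.

Lemma qprod_eq0 s : qprod s = 0 -> exists s1 i j s2,
  s = s1 ++ [:: i, j & s2] /\ turn j = - turn i.
Proof.
have N i : unit_vec (- turn i) by apply/unit_vecN/turn_unit.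
(* The first projector is kept apart from the rest of the product, so that [pauli_mul_neq0] can glue
   it to the preceding one. *)
have H : forall i t,
    (exists s1 a b s2, i :: t = s1 ++ [:: a, b & s2] /\ turn b = - turn a) \/
    pauli (- turn i) *m qprod t != 0.
  move=> i t; elim: t i => [|j t IH] i.
    by right; rewrite /qprod big_nil mulmx1 pauli_neq0.
  have [E|ne] := eqVneq (pauli (- turn i) *m pauli (- turn j)) 0.
    left; exists [::], i, j, t; split=> //; apply: oppr_inj.
    exact: (pauli_mul_eq0 (N i) (N j) E).
  have [[s1 [a [b [s2 [-> E]]]]]|IHj] := IH j.
    by left; exists (i :: s1), a, b, s2.
  right; rewrite /qprod big_cons -mulmxE mulmxA.
  exact: (pauli_mul_neq0 (N j)).
case: s => [|i t].
  by rewrite /qprod big_nil => /eqP; rewrite oner_eq0.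
have [//|] := H i t; rewrite /qprod big_cons -mulmxE => ne E.
by rewrite E eqxx in ne.
Qed.

(** At [t = 0] the product is [diag (0, 1)], and multiplying on the left by the first projector
    leaves it unchanged. The last diagonal entry of that projector is therefore 1, which forces the
    first point to be the north pole. *)
Lemma turn_prod_rays s : turn_prod s = diagp (size s) 0 ->
  forall i, i \in s -> turn i = north R.
Proof.
elim: s => // i s IH; rewrite turn_prod_cons /= => E.
have ti : turn i = north R.
  have := congr1 (map_mx (horner_eval 0)) E.
  rewrite -turn_prod_cons turn_prod_horner0 /qprod big_cons -mulmxE.
  move=> /(congr1 (mulmx (pauli (- turn i)))).
  rewrite mulmxA pauli_idem; last by apply/unit_vecN/turn_unit.
  move=> /[dup] E0; have := congr1 (map_mx (horner_eval 0)) E.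
  rewrite -turn_prod_cons turn_prod_horner0 /qprod big_cons -mulmxE => -> /matrixP/(_ 1 1).
  rewrite mulmx2E !mxE /= /horner_eval horner0 hornerC mulr0 add0r mulr1.
  rewrite expr1 => /(congr1 (@complex.Re R)) /= H.
  have t3 : turn i 0 ord_max = 1 by move: H; rewrite !mxE; lra.
  have S := turn_unit i; rewrite /unit_vec sum3E t3 expr1n in S.
  have /eqP : turn i 0 0 ^+ 2 + turn i 0 1 ^+ 2 = 0 by lra.
  rewrite paddr_eq0 ?sqr_ge0 // !sqrf_eq0 => /andP[/eqP t0 /eqP t1].
  by apply: row3P; rewrite ?t0 ?t1 ?t3 !mxE.
move=> j; rewrite inE => /orP[/eqP ->//|]; apply: IH.
apply: scaleX_inj => /=.
(* Multiplication by [diag (1, t)] completes the first factor [diag (t, 1)] to the scalar [t], which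
   cancels. *)
have := congr1 (mulmx (diagp 0 1)) E.
rewrite ti lfactor_north mulmxA !diagp_mul !addn0 !add0n.
rewrite (diagp_scalar 1) mul_scalar_mx expr1 => ->.
by rewrite diagpS.
Qed.

Lemma turn_prod_matching_ex s a b : sorted alternating s -> size s = (a + b)%N -> (b <= a)%N ->
  turn_prod s = diagp a b ->
  exists A B, [/\ matching_on s b (a - b) A B,
    (forall i j, (i, j) \in A -> y i = y j) &
    (forall i, i \in B -> y i = (-1) ^+ i.+1 *: north R)].
Proof.
elim: b a s => [|b IH] a s ss sz ba E.
  exists finset.set0, [set i in s]; split.
  - split; rewrite ?cards0 //.
    + split=> //; rewrite subn0 cardsE (card_uniqP (alternating_uniq ss)) sz; lia.
    + by move=> e; rewrite inE.
    + move=> v; rewrite inE /incident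
        (_ : [set e in finset.set0 | _] = finset.set0) ?cards0 //.
      by apply/finset.setP => e; rewrite !inE.
    + by move=> e f; rewrite inE.
    + by move=> e f; rewrite inE.
  - by move=> i j; rewrite inE.
  - move=> i; rewrite inE => si; apply/turn_north; apply: (turn_prod_rays _ si).
    by rewrite E sz addn0.
case: a ba sz E => // a ba sz E.
(* Both diagonal exponents are positive, so the product vanishes at [t = 0]; this produces two
   antipodal neighbours to be joined by an arc. *)
have q0 : qprod s = 0.
  rewrite -turn_prod_horner0 E diagpS; apply/matrixP => i j.
  by rewrite !mxE /horner_eval hornerM hornerX mul0r.
have [s1 [i [j [s2 [sE tij]]]]] := qprod_eq0 q0.
have aij : alternating i j.
  by move: ss; rewrite sE; case: (s1) => [|z t] /=; rewrite ?cat_path /=;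
    [case/andP|case/and4P].
rewrite sE in ss sz E *.
have [||| A [B [M yA yB]]] := IH a (s1 ++ s2) (alternating_remove ss).
- by move: sz; rewrite !size_cat /=; lia.
- by [].
- by apply: scaleX_inj; rewrite /= -(turn_prod_remove _ _ tij) E diagpS.
exists ((i, j) |: A), B; split=> //.
- by rewrite subSS; exact: matching_on_add.
- move=> i' j'; rewrite !inE => /orP[/eqP[-> ->]|/yA //].
  exact/(turn_alt aij).
Qed.

End MatchingProducts.

(** * The two smooth maps *)

Section JordanBasis.
Context {R : realType} {n : nat} (k : nat).
Local Notation C := R[i].
Implicit Types (h u L : 'M[C]_n).

Definition jordan_basis (Gamma : 'End('rV[C]_n)) (E : 'M[C]_n) :=
  E \in unitmx /\ forall c : 'rV[C]_n, Gamma (c *m E) = (c *m shift_mx k) *m E.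

Lemma jordan_basis_ex (Gamma : 'End('rV[C]_n)) :
  nilpotent_two_blocks k Gamma -> exists E, jordan_basis Gamma E.
Proof.
move=> [e eb eG]; exists (\matrix_i e`_i).
set E := \matrix_i _; have rE (i : 'I_n) : row i E = e`_i by rewrite rowK.
split.
  apply: unitmx_ker => c; rewrite mulmx_sum_row; under eq_bigr do rewrite rE.
  have /freeP fe := basis_free eb; move/fe => c0.
  by apply/rowP => i; rewrite c0 mxE.
move=> c; rewrite [c *m E]mulmx_sum_row linear_sum -mulmxA mulmx_sum_row.
apply: eq_bigr => i _; rewrite linearZ /= rE eG row_mul; congr (_ *: _).
have [i0|] := boolP ((i == 0%N :> nat) || (i == (n - k)%N :> nat)).
  suff -> : row i (shift_mx k : 'M[C]_n) = 0 by rewrite mul0mx.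
  apply/rowP => j; rewrite !mxE.
  by case/orP: i0 => /eqP ->; rewrite eqxx ?andbF.
rewrite negb_or => /andP[i0 ink].
have pi : (i.-1 < n)%N by rewrite (leq_trans _ (ltn_ord i)) // ltnS leq_pred.
have -> : row i (shift_mx k : 'M[C]_n) = delta_mx 0 (Ordinal pi).
  apply/rowP => j; rewrite !mxE i0 ink /= -val_eqE /=.
  by congr (_%:R); congr nat_of_bool; lia.
by rewrite -rowE rE.
Qed.

Lemma springerP (Gamma : 'End('rV[C]_n)) E h (hu : h *m E \in unitmx) :
  jordan_basis Gamma E ->
  springer Gamma (row_flag hu) <->
  exists2 L, is_trig_mx L & h *m shift_mx k = L *m h.
Proof.
move=> [Eu GE]; split=> [S|[L Lt hL] i].
  have /choice[L LP] (i : 'I_n) : exists l : 'rV[C]_n,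
      (forall j : 'I_n, (i < j)%N -> l 0 j = 0) /\
      row i h *m shift_mx k = l *m h.
    have vi : row i h *m E \in row_flag_fun (h *m E) i.
      apply/row_flag_funP; exists (delta_mx 0 i); last by rewrite mulmxA -rowE.
      by move=> j ij; rewrite mxE -[j == i]val_eqE gtn_eqF.
    have /row_flag_funP[l l0] := subvP (S i) _ (memv_img Gamma vi).
    rewrite GE mulmxA => /(congr1 (mulmx^~ (invmx E))); rewrite !mulmxK // => lE.
    by exists l.
  exists (\matrix_i L i).
    by apply/is_trig_mxP => i j ij; rewrite mxE; exact: (LP i).1.
  by apply/row_matrixP => i; rewrite row_mul (LP i).2 row_mul rowK.
apply/subvP => _ /memv_imgP[v /row_flag_funP[c c0 ->] ->].
suff: Gamma (c *m (h *m E)) \in row_flag_fun (h *m E) i by [].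
rewrite mulmxA GE -[c *m h *m _]mulmxA hL !mulmxA.
rewrite -mulmxA; apply/row_flag_funP; exists (c *m L) => // j ij.
rewrite mxE big1 // => l _; have [il|li] := ltnP i l; first by rewrite c0 ?mul0r.
by rewrite (is_trig_mxP Lt) ?mulr0 //; exact: leq_ltn_trans ij.
Qed.

(* The diagonal entries of [L] are eigenvalues of a nilpotent matrix. *)
Lemma shift_conj_strict h L : h \in unitmx -> is_trig_mx L ->
  h *m shift_mx k = L *m h -> forall i j : 'I_n, (i <= j)%N -> L i j = 0.
Proof.
move=> hu Lt hL i j; rewrite leq_eqVlt => /orP[/eqP/val_inj <-|]; last first.
  exact: (is_trig_mxP Lt).
have : eigenvalue L (L i i).
  rewrite eigenvalue_root_char char_poly_trig // (bigD1 i) //=.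
  by rewrite rootM root_XsubC eqxx.
move/eigenvalueP => [v vL v0].
have : eigenvalue (shift_mx k : 'M[C]_n) (L i i).
  apply/eigenvalueP; exists (v *m h).
    by rewrite -mulmxA hL mulmxA vL scalemxAl.
  by apply: contraNneq v0 => vh; rewrite -(mulmxK hu v) vh mul0mx.
rewrite eigenvalue_root_char char_poly_trig; last exact: shift_mx_trig.
under eq_bigr do rewrite shift_mx_diag subr0.
rewrite prodr_const rootE horner_exp hornerX expf_eq0.
by move=> /andP[_ /eqP].
Qed.

End JordanBasis.

(** * Orthogonal representatives of flags *)

Section Orthogonalization.
Context {R : realType} {n : nat}.
Local Notation C := R[i].
Local Notation "A ^*m" := (map_mx Num.conj (A^T)) (at level 8).
Implicit Types (h u L A : 'M[C]_n).

Lemma adjM m p q (A : 'M[C]_(m, p)) (B : 'M[C]_(p, q)) :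
  (A *m B)^*m = B^*m *m A^*m.
Proof. by rewrite trmx_mul map_mxM. Qed.

Lemma row_norm_eq0 (c : 'rV[C]_n) : c *m c^*m = 0 -> c = 0.
Proof.
move=> /matrixP/(_ 0 0); rewrite !mxE => /eqP; rewrite psumr_eq0 => [/allP c0|j _].
  apply/rowP => j; have /= := c0 j; rewrite mem_index_enum => /(_ isT).
  by rewrite !mxE mul_conjC_eq0 => /eqP.
by rewrite !mxE mul_conjC_ge0.
Qed.

(** The leading block is the Gram matrix of the first [m] rows of [A], which are independent: for
    [c] in its kernel, the truncation [c'] gives a combination [c' *m A] of norm zero. *)
Lemma gram_lead_unit A m : A \in unitmx -> lead_mx m (A *m A^*m) \in unitmx.
Proof.
move=> Au; set G := A *m A^*m; apply: unitmx_ker => c c0.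
pose c' : 'rV[C]_n := \row_i if (i < m)%N then c 0 i else 0.
have cG (b : 'I_n) : (b < m)%N -> (c' *m G) 0 b = 0.
  move=> bm; move/rowP/(_ b): c0; rewrite [RHS]mxE => <-; rewrite [LHS]mxE [RHS]mxE.
  apply: eq_bigr => a _; rewrite [c' 0 a]mxE [lead_mx _ _ _ _]mxE bm andbT.
  case: ltnP => // ma; rewrite mul0r (_ : (a == b) = false) ?mulr0 //.
  by apply/negP => /eqP ab; move: bm; rewrite -ab ltnNge ma.
have cb (b : 'I_n) : (m <= b)%N -> c 0 b = 0.
  move=> mb; move/rowP/(_ b): c0; rewrite [RHS]mxE => <-; rewrite [RHS]mxE.
  rewrite (bigD1 b) //= [lead_mx _ _ _ _]mxE [(b < m)%N]ltnNge mb eqxx mulr1.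
  rewrite big1 ?addr0 // => a ab.
  by rewrite [lead_mx _ _ _ _]mxE [(b < m)%N]ltnNge mb andbF (negbTE ab) mulr0.
have c'0 : c' = 0.
  have : c' *m A = 0.
    apply: row_norm_eq0; rewrite adjM mulmxA -[c' *m A *m _]mulmxA -/G.
    apply/matrixP => i j; rewrite (ord1 i) (ord1 j) mxE [RHS]mxE big1 // => b _.
    have [bm|mb] := ltnP b m; first by rewrite cG // mul0r.
    by rewrite !mxE ltnNge mb /= conjC0 mulr0.
  by move/(congr1 (mulmx^~ (invmx A))); rewrite mulmxK // mul0mx.
apply/rowP => b; have [bm|mb] := ltnP b m; last by rewrite cb // mxE.
by move/rowP/(_ b): c'0; rewrite !mxE bm.
Qed.

(* Gram-Schmidt: eliminating in the Gram matrix orthogonalizes the rows. *)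
Definition orth_mx A : 'M[C]_n := elim_mx (A *m A^*m) *m A.

Definition orth_rows u := forall i j, i != j -> (u *m u^*m) i j = 0.

Lemma elim_gram_unit A : A \in unitmx -> elim_mx (A *m A^*m) \in unitmx.
Proof.
move=> Au; have Gl m := gram_lead_unit m Au.
have : elim_mx (A *m A^*m) *m (A *m A^*m) \in unitmx.
  rewrite -unitmx_tr unitmxE det_trig; last first.
    apply/is_trig_mxP => i j ij; rewrite mxE elim_mxE //; last exact: ltnW.
    by rewrite -val_eqE gtn_eqF.
  by rewrite big1 ?unitr1 // => i _; rewrite mxE elim_mxE // eqxx.
by rewrite unitmx_mul => /andP[].
Qed.

Lemma orth_mx_unit A : A \in unitmx -> orth_mx A \in unitmx.
Proof. by move=> Au; rewrite unitmx_mul elim_gram_unit. Qed.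

Lemma adj_sym u (i j : 'I_n) : (u *m u^*m) j i = ((u *m u^*m) i j)^*.
Proof.
rewrite !mxE rmorph_sum; apply: eq_bigr => l _; rewrite !mxE rmorphM mulrC.
by congr (_ * _); exact/esym/conjCK.
Qed.

(** With [G] the Gram matrix and [L] its elimination, the new Gram matrix is [L G] times the adjoint
    of [L], a product of upper triangular matrices. Being Hermitian, it is diagonal. *)
Lemma orth_mx_rows A : A \in unitmx -> orth_rows (orth_mx A).
Proof.
move=> Au; have Gl m := gram_lead_unit m Au; set G := A *m A^*m in Gl.
have H (i j : 'I_n) : (j < i)%N -> (orth_mx A *m (orth_mx A)^*m) i j = 0.
  move=> ji; rewrite /orth_mx adjM mulmxA -[_ *m A *m _]mulmxA -/G mxE.
  rewrite big1 // => l _; have [li|il] := ltnP l i.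
    by rewrite elim_mxE ?(ltnW li) // -val_eqE gtn_eqF // mul0r.
  rewrite [X in _ * X]mxE [X in X^*]mxE (is_trig_mxP (elim_mx_trig Gl)) ?conjC0 ?mulr0 //.
  exact: leq_trans il.
move=> i j; rewrite -val_eqE neq_ltn => /orP[ij|]; last exact: H.
by rewrite adj_sym H // conjC0.
Qed.

(** The rows of [u] are coordinates in the basis [E]: orthogonality refers to the Hermitian product
    for which [E] is orthonormal. *)
Lemma flag_orth (V : flag R n) E : E \in unitmx ->
  exists u, exists hu : u *m E \in unitmx, V = row_flag hu /\ orth_rows u.
Proof.
move=> Eu; have [h [hu ->]] := row_flag_surj V.
have Au : h *m invmx E \in unitmx by rewrite unitmx_mul hu unitmx_inv.
have uE : orth_mx (h *m invmx E) *m E \in unitmx by rewrite unitmx_mul orth_mx_unit.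
exists (orth_mx (h *m invmx E)), uE; split; last exact: orth_mx_rows.
apply/esym/row_flag_eqP; exists (elim_mx ((h *m invmx E) *m (h *m invmx E)^*m)).
  by apply: elim_mx_trig => m; exact: gram_lead_unit.
by rewrite /orth_mx -!mulmxA mulVmx // mulmx1.
Qed.

Lemma orth_rows_norm u i : u \in unitmx -> (u *m u^*m) i i != 0.
Proof.
move=> uu; apply/eqP => E.
have : row i u = 0.
  apply: row_norm_eq0; apply/matrixP => a b; rewrite (ord1 a) (ord1 b) [RHS]mxE -E !mxE.
  by apply: eq_bigr => l _; rewrite !mxE.
rewrite rowE => /(congr1 (mulmx^~ (invmx u))); rewrite mulmxK // mul0mx.
by move/rowP/(_ i); rewrite !mxE !eqxx => /eqP; rewrite oner_eq0.
Qed.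

(** The products of the rows of [u'] with those of [u], computed through [L] and, after conjugation,
    through [L'], show that an entry of [L] below the diagonal is proportional to one of [L'] above
    it. *)
Lemma orth_trig_diag u u' L L' : u \in unitmx -> orth_rows u -> orth_rows u' ->
  is_trig_mx L -> is_trig_mx L' -> u' = L *m u -> u = L' *m u' ->
  forall i j, i != j -> L i j = 0.
Proof.
move=> uu ou ou' Lt Lt' E E' i j; rewrite -val_eqE neq_ltn => /orP[ij|ji].
  exact: (is_trig_mxP Lt).
have H (v v' N : 'M[C]_n) a b : orth_rows v -> v' = N *m v ->
    (v' *m v^*m) a b = N a b * (v *m v^*m) b b.
  move=> ov ->; rewrite -mulmxA mxE (bigD1 b) //= big1 ?addr0 // => l lb.
  by rewrite ov ?mulr0.
have : (u' *m u^*m) i j = ((u *m u'^*m) j i)^*.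
  rewrite !mxE rmorph_sum; apply: eq_bigr => l _; rewrite !mxE rmorphM mulrC.
  by congr (_ * _); exact/esym/conjCK.
rewrite (H u u' L) // (H u' u L') // (is_trig_mxP Lt' _ _ ji) mul0r conjC0.
by move/eqP; rewrite mulf_eq0 (negbTE (orth_rows_norm j uu)) orbF => /eqP.
Qed.

(** Makes the lines read off from an orthogonal representative depend on the flag alone. *)
Lemma row_flag_orth_unique E u u' (hu : u *m E \in unitmx) (hu' : u' *m E \in unitmx) :
  orth_rows u -> orth_rows u' -> row_flag hu' = row_flag hu ->
  forall i, exists2 a : C, a != 0 & row i u' = a *: row i u.
Proof.
move=> ou ou' fE i.
have [uu Eu] : u \in unitmx /\ E \in unitmx by apply/andP; rewrite -unitmx_mul.
have uu' : u' \in unitmx by have := hu'; rewrite unitmx_mul => /andP[].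
have cancelE L (v v' : 'M[C]_n) : v *m E = L *m (v' *m E) -> v = L *m v'.
  by rewrite mulmxA => /(congr1 (mulmx^~ (invmx E))); rewrite !mulmxK.
have [L Lt /cancelE LE] := (row_flag_eqP hu' hu).2 fE.
have [L' Lt' /cancelE LE'] := (row_flag_eqP hu hu').2 (esym fE).
have rE : row i u' = L i i *: row i u.
  rewrite LE; apply/rowP => j; rewrite !mxE (bigD1 i) //= big1 ?addr0 // => l li.
  by rewrite (orth_trig_diag uu ou ou' Lt Lt' LE LE') ?mul0r // eq_sym.
exists (L i i) => //; apply/eqP => L0; have := orth_rows_norm i uu'.
suff -> : (u' *m u'^*m) i i = 0 by rewrite eqxx.
rewrite mxE big1 // => l _; have := rE; rewrite L0 scale0r => /rowP/(_ l).
by rewrite !mxE => ->; rewrite mul0r.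
Qed.

End Orthogonalization.

(** * The map from flags to points of the spheres *)

Section FlagToSpheresMap.
Context {R : realType} {n : nat} (k : nat).
Local Notation C := R[i].
Local Notation "A ^*m" := (map_mx Num.conj (A^T)) (at level 8).
Variable E : 'M[C]_n.
Hypothesis Eu : E \in unitmx.
Implicit Types (u : 'M[C]_n) (V : flag R n).

Definition eval_one (c : 'rV[C]_n) : 'cV[C]_2 :=
  map_mx (horner_eval 1) (vec_poly k c).

Lemma eval_oneE c b : eval_one c b 0 = \sum_j c 0 j * (b == blk k j)%:R.
Proof.
rewrite mxE summxE /horner_eval horner_sum; apply: eq_bigr => j _.
rewrite !mxE hornerM hornerC; congr (_ * _).
by case: eqP => _; rewrite ?hornerXn ?expr1n ?horner0.
Qed.

Lemma eval_oneZ a c : eval_one (a *: c) = a *: eval_one c.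
Proof.
apply/matrixP => b j; rewrite (ord1 j) eval_oneE mxE eval_oneE mulr_sumr.
by apply: eq_bigr => l _; rewrite mxE mulrA.
Qed.

Lemma hopfZ (a : C) w : a != 0 -> w != 0 -> hopf (a *: w) = hopf w.
Proof.
move=> a0 w0; apply: hopf_unique; first by rewrite scaler_eq0 negb_or a0.
by rewrite -scalemxAr hopf_fix.
Qed.

Lemma north_sphere_subproof : \sum_j north R 0 j ^+ 2 == 1.
Proof. by apply/eqP; exact: north_unit. Qed.

Definition north_sphere : sphere R := exist _ (north R) north_sphere_subproof.

(** An arbitrary choice: the charts may use the rational representative [orth_mx (chart_mx x)]
    instead, because [hopf] is insensitive to scaling. *)
Definition orth_rep V : 'M[C]_n := xget 0
  [set u | exists hu : u *m E \in unitmx, V = row_flag hu /\ orth_rows u].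

Lemma orth_repP V : exists hu : orth_rep V *m E \in unitmx,
  V = row_flag hu /\ orth_rows (orth_rep V).
Proof. by have := xgetPex 0 (flag_orth V Eu). Qed.

(** Where an evaluation vanishes, [hopf] is the zero vector and [insubd] falls back on the north
    pole; [flag_domain] excludes such flags. *)
Definition flag_spheres V : {ffun 'I_n -> sphere R} :=
  [ffun i : 'I_n => insubd north_sphere
     ((-1) ^+ i.+1 *: hopf (eval_one (row i (orth_rep V))))].

Definition flag_domain : set (flag R n) :=
  [set V | forall i, eval_one (row i (orth_rep V)) != 0].

Section Representative.
Variables (u : 'M[C]_n) (hu : u *m E \in unitmx).
Hypothesis ou : orth_rows u.

Lemma orth_rep_row i : exists2 a : C, a != 0 &
  row i (orth_rep (row_flag hu)) = a *: row i u.
Proof.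
have [hu' [VE ou']] := orth_repP (row_flag hu).
exact: row_flag_orth_unique ou ou' (esym VE) i.
Qed.

Lemma flag_domain_row i : (eval_one (row i (orth_rep (row_flag hu))) != 0) =
  (eval_one (row i u) != 0).
Proof.
have [a a0 ->] := orth_rep_row i.
by rewrite eval_oneZ scaler_eq0 (negbTE a0).
Qed.

Lemma flag_spheresE i : eval_one (row i u) != 0 ->
  val (flag_spheres (row_flag hu) i) = (-1) ^+ i.+1 *: hopf (eval_one (row i u)).
Proof.
move=> w0; have [a a0 rE] := orth_rep_row i.
rewrite ffunE rE eval_oneZ hopfZ // insubdK //.
rewrite unfold_in -[X in _ == X](hopf_unit w0); apply/eqP.
by apply: eq_bigr => j _; rewrite mxE exprMn sqrr_sign mul1r.
Qed.

End Representative.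

Section Chart.
Variable g : {g : 'M[C]_n | g \in unitmx}.
Local Notation D := (#|upper_pairs n| + #|upper_pairs n|)%N.

Definition chart_mx (x : 'rV[R]_D) : 'M[C]_n := unitri x *m val g *m invmx E.

Lemma chart_mx_unit x : chart_mx x \in unitmx.
Proof. by rewrite unitmx_mul unitri_mul_unit unitmx_inv. Qed.

Lemma chart_orth_unit x : orth_mx (chart_mx x) *m E \in unitmx.
Proof. by rewrite unitmx_mul orth_mx_unit ?chart_mx_unit. Qed.

Lemma chart_orthE x :
  @param _ _ (flag_atlas R n) g x = row_flag (chart_orth_unit x).
Proof.
apply/esym/row_flag_eqP.
exists (elim_mx (chart_mx x *m (chart_mx x)^*m)).
  by apply: elim_mx_trig => m; apply: gram_lead_unit; exact: chart_mx_unit.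
by rewrite /orth_mx /chart_mx -!mulmxA mulVmx // mulmx1.
Qed.

Lemma mx_rational_adj d (U : set 'rV[R]_d) p q (M : 'rV[R]_d -> 'M[C]_(p, q)) :
  mx_rational_on U M -> mx_rational_on U (fun x => (M x)^*m).
Proof.
move=> Mr i j; under eq_fun do rewrite mxE mxE.
exact: crational_conj.
Qed.

Lemma chart_orth_rational U : mx_rational_on U (fun x => orth_mx (chart_mx x)).
Proof.
have Ar : mx_rational_on U chart_mx.
  apply: mx_rational_mul; last exact: mx_rational_cst.
  by apply: mx_rational_mul; [exact: mx_rational_unitri|exact: mx_rational_cst].
apply: mx_rational_mul => //; apply: mx_rational_elim.
  by move=> x _ m; apply: gram_lead_unit; exact: chart_mx_unit.
by apply: mx_rational_mul => //; exact: mx_rational_adj.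
Qed.

Definition chart_vec i x := eval_one (row i (orth_mx (chart_mx x))).

Lemma chart_vec_rational U i b : crational_on U (fun x => chart_vec i x b 0).
Proof.
under eq_fun do rewrite eval_oneE.
apply: crational_sum => j _; apply: crational_mul; last exact: crational_cst.
by under eq_fun do rewrite mxE; exact: chart_orth_rational.
Qed.

Lemma chart_normsq_rational U i : rational_on U (fun x => normsq (chart_vec i x)).
Proof.
have [r0 i0] := chart_vec_rational U i 0; have [r1 i1] := chart_vec_rational U i 1.
by apply: rational_add; apply: rational_add; apply: rational_mul.
Qed.

Lemma chart_domainP x :
  flag_domain (@param _ _ (flag_atlas R n) g x) <-> forall i, chart_vec i x != 0.
Proof.
have ou := orth_mx_rows (chart_mx_unit x).
by rewrite chart_orthE; split=> H i; have := H i; rewrite flag_domain_row.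
Qed.

Lemma hopf_rational d (U : set 'rV[R]_d) (w : 'rV[R]_d -> 'cV[C]_2) c :
  (forall x, U x -> w x != 0) -> (forall b, crational_on U (fun x => w x b 0)) ->
  rational_on U (fun x => hopf (w x) 0 c).
Proof.
move=> w0 wr; have [r0 i0] := wr 0; have [r1 i1] := wr 1.
have Z := crational_mul (wr 1) (crational_conj (wr 0)).
under eq_fun do rewrite !mxE.
apply: rational_mul.
  apply: rational_inv; first by move=> x Ux; rewrite normsq_eq0 w0.
  by apply: rational_add; apply: rational_add; apply: rational_mul.
case: (c == 0); first by apply: rational_mul; [exact: rational_cst|exact: Z.1].
case: (c == 1); first by apply: rational_mul; [exact: rational_cst|exact: Z.2].
apply: rational_add; first by apply: rational_add; apply: rational_mul.
by apply: rational_opp; apply: rational_add; apply: rational_mul.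
Qed.

End Chart.

Lemma flag_domain_open : manifold_open (flag_atlas R n) flag_domain.
Proof.
move=> g; have -> : @param _ _ (flag_atlas R n) g @^-1` flag_domain =
    [set x | setT x /\ \prod_i normsq (chart_vec g i x) != 0].
  apply/seteqP; split=> x /= => [/chart_domainP H|[_ /prodf_neq0 H]].
    by split=> //; apply/prodf_neq0 => i _; rewrite normsq_eq0 H.
  by apply/chart_domainP => i; rewrite -normsq_eq0 H.
apply: (rational_open_neq0 (f := fun x => \prod_i normsq (chart_vec g i x))).
  exact: openT.
have : forall r : seq 'I_n,
    rational_on setT (fun x => \prod_(i <- r) normsq (chart_vec g i x)).
  elim=> [|i r IH].
    by apply: rational_ext (rational_cst _ 1) => x _; rewrite big_nil.
  apply: rational_ext (rational_mul (chart_normsq_rational g setT i) IH) => x _.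
  by rewrite big_cons.
exact.
Qed.

Lemma flag_spheres_smooth :
  smooth_on_open (flag_atlas R n) (spheres_atlas R n) flag_domain flag_spheres.
Proof.
apply: smooth_into_spheres; first exact: flag_domain_open.
move=> g j c; set U := _ @^-1` _.
have Uw x : U x -> chart_vec g j x != 0 by move/chart_domainP.
have Hr : rational_on U (fun x => hopf (chart_vec g j x) 0 c).
  by apply: hopf_rational => // b; exact: chart_vec_rational.
apply: rational_ext (rational_mul (rational_cst U ((-1) ^+ j.+1)) Hr) => x Ux.
have ou := orth_mx_rows (chart_mx_unit g x).
by rewrite chart_orthE flag_spheresE ?mxE //; exact: Uw.
Qed.

End FlagToSpheresMap.

Section PolyRational.
Context {R : realType} {d : nat}.
Local Notation C := R[i].
Local Notation "A %:PM" := (map_mx polyC A) (at level 2).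
Implicit Types (U : set 'rV[R]_d).

Definition pmx_rational_on U p q (M : 'rV[R]_d -> 'M[{poly C}]_(p, q)) :=
  forall i j m, crational_on U (fun x => (M x i j)`_m).

Lemma pmx_rational_mul U p q r (M : 'rV[R]_d -> 'M[{poly C}]_(p, q))
    (N : 'rV[R]_d -> 'M[{poly C}]_(q, r)) :
  pmx_rational_on U M -> pmx_rational_on U N ->
  pmx_rational_on U (fun x => M x *m N x).
Proof.
move=> MU NU i j m; under eq_fun do rewrite mxE coef_sum.
apply: crational_sum => l _; under eq_fun do rewrite coefM.
by apply: crational_sum => a _; apply: crational_mul; [exact: MU|exact: NU].
Qed.

Lemma pmx_rational_add U p q (M N : 'rV[R]_d -> 'M[{poly C}]_(p, q)) :
  pmx_rational_on U M -> pmx_rational_on U N ->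
  pmx_rational_on U (fun x => M x + N x).
Proof.
move=> MU NU i j m; under eq_fun do rewrite mxE coefD.
by apply: crational_add; [exact: MU|exact: NU].
Qed.

Lemma pmx_rational_X U p q (M : 'rV[R]_d -> 'M[{poly C}]_(p, q)) :
  pmx_rational_on U M -> pmx_rational_on U (fun x => 'X *: M x).
Proof.
move=> MU i j m; under eq_fun do rewrite mxE coefXM.
by case: (m == 0%N); [exact: crational_cst|exact: MU].
Qed.

Lemma pmx_rational_C U p q (M : 'rV[R]_d -> 'M[C]_(p, q)) :
  mx_rational_on U M -> pmx_rational_on U (fun x => (M x)%:PM).
Proof.
move=> MU i j m; under eq_fun do rewrite mxE coefC.
by case: (m == 0%N); [exact: MU|exact: crational_cst].
Qed.

Definition vec_rational_on U (v : 'rV[R]_d -> 'rV[R]_3) :=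
  forall c, rational_on U (fun x => v x 0 c).

Lemma vec_rational_scale U v a : vec_rational_on U v ->
  vec_rational_on U (fun x => a *: v x).
Proof.
move=> vU c; under eq_fun do rewrite mxE.
by apply: rational_mul; [exact: rational_cst|exact: vU].
Qed.

Lemma mx_rational_pauli U v : vec_rational_on U v ->
  mx_rational_on U (fun x => pauli (v x)).
Proof.
move=> vU i j; under eq_fun do rewrite mxE.
case: (i == j); apply: crational_complex.
- apply: rational_mul; last exact: rational_cst.
  apply: rational_add; first exact: rational_cst.
  by apply: rational_mul; [exact: rational_cst|exact: vU].
- exact: rational_cst.
- by apply: rational_mul; [exact: vU|exact: rational_cst].
- apply: rational_mul; last exact: rational_cst.
  by apply: rational_mul; [exact: rational_cst|exact: vU].
Qed.

Lemma pmx_rational_lfactor U v : vec_rational_on U v ->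
  pmx_rational_on U (fun x => lfactor (v x)).
Proof.
move=> vU; apply: pmx_rational_add.
  apply: (pmx_rational_C (M := fun x => pauli (- v x))); apply: mx_rational_pauli.
  under eq_fun do rewrite -scaleN1r; exact: vec_rational_scale.
apply: pmx_rational_X; apply: (pmx_rational_C (M := fun x => pauli (v x))).
exact: mx_rational_pauli.
Qed.

Lemma pmx_rational_Phi U (v : 'rV[R]_d -> nat -> 'rV[R]_3) m :
  (forall i, vec_rational_on U (fun x => v x i)) ->
  pmx_rational_on U (fun x => Phi (v x) m).
Proof.
move=> vU; elim: m => [|m IH].
  move=> i j l; under eq_fun do rewrite Phi0; exact: crational_cst.
have := pmx_rational_mul IH (pmx_rational_lfactor (vU m)).
by move=> H i j l; under eq_fun do rewrite PhiS; exact: H.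
Qed.

End PolyRational.

(** * The map from points of the spheres to flags *)

Section SpheresToFlagMap.
Context {R : realType} {n : nat} (k : nat).
Local Notation C := R[i].
Local Notation "A %:PM" := (map_mx polyC A) (at level 2).
Variable E : 'M[C]_n.
Implicit Types (y : {ffun 'I_n -> sphere R}) (c : nat -> 'I_2).

Definition points y (i : 'I_n) : 'rV[R]_3 := val (y i).

Lemma points_unit y i : unit_vec (points y i).
Proof. exact/eqP/(valP (y i)). Qed.

(** The default north pole keeps every term of the sequence a unit vector. *)
Definition turns y (m : nat) : 'rV[R]_3 :=
  if insub m is Some i then turn (points y) i else north R.

Lemma turns_unit y m : unit_vec (turns y m).
Proof.
rewrite /turns; case: insubP => [i _ _|_]; last exact: north_unit.
by apply: turn_unit => j; exact: points_unit.
Qed.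

Lemma turns_ord y (i : 'I_n) : turns y i = turn (points y) i.
Proof. by rewrite /turns valK. Qed.

(** A column of the projector generates the line wherever it is nonzero and is rational in the
    point. No continuous generator exists over the whole sphere, hence the parameter [c] choosing
    the column. *)
Definition pauli_col y c m : 'cV[C]_2 := pauli (turns y m) *m delta_mx (c m) 0.

Lemma pauli_col_fix y c m : pauli (turns y m) *m pauli_col y c m = pauli_col y c m.
Proof. by rewrite /pauli_col mulmxA pauli_idem //; exact: turns_unit. Qed.

Definition nonzero_col y m : 'I_2 :=
  if pauli (turns y m) *m delta_mx 0 0 != 0 :> 'cV[C]_2 then 0 else 1.

Lemma nonzero_colP y m : pauli_col y (nonzero_col y) m != 0.
Proof.
rewrite /pauli_col /nonzero_col; case: ifP => // /negbFE/eqP c0.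
apply/eqP => c1; have /eqP := pauli_neq0 (turns y m); apply.
rewrite -!colE in c0 c1; apply: matrix2P; rewrite [RHS]mxE.
- by move/matrixP/(_ 0 0): c0; rewrite [LHS]mxE [RHS]mxE.
- by move/matrixP/(_ 0 0): c1; rewrite [LHS]mxE [RHS]mxE.
- by move/matrixP/(_ 1 0): c0; rewrite [LHS]mxE [RHS]mxE.
- by move/matrixP/(_ 1 0): c1; rewrite [LHS]mxE [RHS]mxE.
Qed.

Definition spheres_mx y c : 'M[C]_n := fvec_mx (turns y) (pauli_col y c) n k.

Lemma spheres_mx_row y c (i : 'I_n) :
  row i (spheres_mx y c) = poly_vec k (fvec (turns y) (pauli_col y c) i).
Proof. exact: rowK. Qed.

Lemma poly_vecZ (a : C) p : poly_vec (n := n) k (a%:P *: p) = a *: poly_vec k p.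
Proof. by apply/rowP => j; rewrite !mxE coefCM. Qed.

Lemma poly_vec_fvecZ (x : nat -> 'rV[R]_3) w w' (a : C) i :
  w i = a *: w' i -> poly_vec (n := n) k (fvec x w i) = a *: poly_vec k (fvec x w' i).
Proof. by move=> wE; rewrite /fvec wE map_mxZ -scalemxAr poly_vecZ. Qed.

Lemma spheres_mx_flag y c (u : 'M[C]_n) (hu : u *m E \in unitmx) :
  (forall i : 'I_n, exists2 a, a != 0 & row i (spheres_mx y c) = a *: row i u) ->
  exists hc : spheres_mx y c *m E \in unitmx, row_flag hc = row_flag hu.
Proof.
move=> /(_ _)/cid2 H; pose D : 'M[C]_n := diag_mx (\row_i sval (H i)).
have Du : D \in unitmx.
  rewrite unitmxE det_diag unitfE; apply/prodf_neq0 => i _; rewrite mxE.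
  exact: (svalP (H i)).1.
have cE : spheres_mx y c = D *m u.
  apply/row_matrixP => i; rewrite row_mul row_diag_mx -scalemxAl -rowE mxE.
  exact: (svalP (H i)).2.
have hc : spheres_mx y c *m E \in unitmx by rewrite cE -mulmxA unitmx_mul Du.
exists hc; apply/row_flag_eqP; exists D; last by rewrite cE mulmxA.
exact: diag_mx_is_trig.
Qed.

Definition spheres_flag y : flag R n := xget (row_flag (unitmx1 C n))
  [set V | exists hu : spheres_mx y (nonzero_col y) *m E \in unitmx, V = row_flag hu].

(** Two nonzero columns of a rank one projector are proportional, so another admissible choice of
    columns only rescales the rows. The pointwise choice [nonzero_col y] can thus be replaced by a
    constant one near any point. *)
Lemma spheres_flagE y c (hu : spheres_mx y c *m E \in unitmx) :
  spheres_flag y = row_flag hu.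
Proof.
have [hc cE] : exists hc : spheres_mx y (nonzero_col y) *m E \in unitmx,
    row_flag hc = row_flag hu.
  apply: spheres_mx_flag => i.
  (* A zero column would make row [i] of the invertible matrix vanish. *)
  have wc0 : pauli_col y c i != 0.
    apply/negP => /eqP w0.
    have r0 : row i (spheres_mx y c *m E) = 0.
      rewrite row_mul spheres_mx_row (@poly_vec_fvecZ _ _ (pauli_col y c) 0).
        by rewrite scale0r mul0mx.
      by rewrite scale0r.
    have : (delta_mx 0 i : 'rV[C]_n) = 0.
      by rewrite -(mulmxK hu (delta_mx 0 i)) -rowE r0 mul0mx.
    by move/rowP/(_ i); rewrite !mxE !eqxx => /eqP; rewrite oner_eq0.
  have [a aE] := pauli_line (turns_unit y i) wc0 (pauli_col_fix y c i)
    (delta_mx (nonzero_col y i) 0).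
  exists a; last first.
    have H1 := spheres_mx_row y c i.
    have H2 := spheres_mx_row y (nonzero_col y) i.
    apply: (etrans H2).
    apply: (etrans _ (congr1 (fun v => a *: v) (esym H1))).
    exact: (@poly_vec_fvecZ (turns y) (pauli_col y (nonzero_col y)) (pauli_col y c) a i aE).
  by apply: contraNneq (nonzero_colP y i) => a0; rewrite /pauli_col aE a0 scale0r.
have [hu' ->] : [set V | exists hu : spheres_mx y (nonzero_col y) *m E \in unitmx,
    V = row_flag hu] (spheres_flag y).
  by apply: xgetPex; exists (row_flag hc), hc.
by apply: (etrans _ cE); rewrite (bool_irrelevance hu' hc).
Qed.

(* With the choice of columns [c] frozen, the matrix depends rationally on [y]. *)
Definition spheres_domain c : set {ffun 'I_n -> sphere R} :=
  [set y | spheres_mx y c *m E \in unitmx].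

Section Chart.
Variable s : 'I_n -> bool.
Notation chart := (@param _ _ (spheres_atlas R n) s).

Lemma stereo_rational U i :
  vec_rational_on U (fun x : 'rV[R]_(n * 2) => points (chart x) i).
Proof.
have wr j : rational_on U (fun x : 'rV[R]_(n * 2) => (row i (vec_mx x) : 'rV_2) 0 j).
  by under eq_fun do rewrite mxE mxE; exact: rational_coord.
have tr : rational_on U (fun x : 'rV[R]_(n * 2) =>
    \sum_j (row i (vec_mx x) : 'rV_2) 0 j ^+ 2).
  by apply: rational_sum => j _; apply: rational_mul.
move=> c; under eq_fun do rewrite /points /= ffunE /= /stereo_fun mxE.
apply: rational_mul.
  apply: rational_inv; last by apply: rational_add => //; exact: rational_cst.
  move=> x _; rewrite gt_eqF // ltr_pwDl //.
  by apply: sumr_ge0 => j _; exact: sqr_ge0.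
case: (@split_ordP 2 1 c) => j ->.
  under eq_fun do rewrite row_mxEl mxE.
  by apply: rational_mul => //; exact: rational_cst.
under eq_fun do rewrite row_mxEr mxE.
rewrite (ord1 j) eqxx; under eq_fun do rewrite mulr1n.
apply: rational_mul; first exact: rational_cst.
by apply: rational_add => //; exact: rational_cst.
Qed.

Lemma turns_rational U m :
  vec_rational_on U (fun x : 'rV[R]_(n * 2) => turns (chart x) m).
Proof.
rewrite /turns; case: insubP => [i _ _|_].
  by apply: vec_rational_scale; exact: stereo_rational.
by move=> c; exact: rational_cst.
Qed.

Lemma spheres_mx_rational U c :
  mx_rational_on U (fun x : 'rV[R]_(n * 2) => spheres_mx (chart x) c).
Proof.
move=> i j; under eq_fun do rewrite mxE mxE.
apply: (pmx_rational_mul (M := fun x => Phi (turns (chart x)) i)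
  (N := fun x => (pauli_col (chart x) c i)%:PM)).
  by apply: (pmx_rational_Phi (v := fun x => turns (chart x))) => m; exact: turns_rational.
apply: (pmx_rational_C (M := fun x => pauli_col (chart x) c i)).
apply: mx_rational_mul; last exact: mx_rational_cst.
by apply: mx_rational_pauli; exact: turns_rational.
Qed.

End Chart.

Lemma spheres_domain_open c : manifold_open (spheres_atlas R n) (spheres_domain c).
Proof.
move=> s; have -> : @param _ _ (spheres_atlas R n) s @^-1` spheres_domain c =
   [set x | setT x /\ \det (spheres_mx (@param _ _ (spheres_atlas R n) s x) c *m E) != 0].
  by apply/seteqP; split=> x; rewrite /= /spheres_domain /= unitmxE unitfE; [|case].
apply: (crational_open_neq0 (f := fun x =>
  \det (spheres_mx (@param _ _ (spheres_atlas R n) s x) c *m E))).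
  exact: openT.
apply: (mx_rational_det (M := fun x =>
  spheres_mx (@param _ _ (spheres_atlas R n) s x) c *m E)).
by apply: mx_rational_mul; [exact: spheres_mx_rational|exact: mx_rational_cst].
Qed.

Lemma spheres_flag_smooth c :
  smooth_on_open (spheres_atlas R n) (flag_atlas R n) (spheres_domain c) spheres_flag.
Proof.
apply: smooth_into_flags; first exact: spheres_domain_open.
move=> s; exists (fun x => spheres_mx (@param _ _ (spheres_atlas R n) s x) c *m E).
  by apply: mx_rational_mul; [exact: spheres_mx_rational|exact: mx_rational_cst].
by move=> x hu; exists hu; exact: spheres_flagE.
Qed.

End SpheresToFlagMap.

Section XSpace.
Context {R : realType} {n k : nat}.
Hypothesis hk : (k <= n./2)%N.
Implicit Types (y : {ffun 'I_n -> sphere R}).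

Lemma alternating_enum : sorted (@alternating n) (enum 'I_n).
Proof.
have : sorted (fun a b => (a < b)%N && (odd a != odd b)) (map val (enum 'I_n)).
  rewrite val_enum_ord; case: n => // m /=.
  elim: m {1 2}0%N => //= m IH a; rewrite ltnSn IH andbT /=.
  by case: (odd a).
by rewrite sorted_map.
Qed.

Lemma Phi_turn_prod y : Phi (turns y) n = turn_prod (points y) (enum 'I_n).
Proof.
rewrite /Phi /turn_prod /index_iota subn0 -val_enum_ord big_map.
by apply: eq_bigr => i _; rewrite turns_ord.
Qed.

Lemma X_spaceP y : X_space R n k y <-> Phi (turns y) n = diag_powers n k.
Proof.
have k2 : (k.*2 <= n)%N by lia.
have pu := points_unit y.
rewrite Phi_turn_prod -[diag_powers n k]/(diagp (n - k) k); split.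
  move=> [a [[cA cB] lt deg nc nr] [yA yB]].
  have -> : (n - k = (n - k.*2) + k)%N by lia.
  apply: (turn_prod_matching pu (A := arcs a) (B := rays a)).
  - exact: alternating_enum.
  - split=> // v; rewrite mem_enum; exact: deg.
  - by move=> i j /yA yij; rewrite /points yij.
  - exact: yB.
move=> E; have [|||A [B [[[cA cB] lt deg nc nr] yA yB]]] := turn_prod_matching_ex pu _ _ _ E.
- exact: alternating_enum.
- by rewrite size_enum_ord; lia.
- lia.
exists (Matching A B).
  split=> //=.
  + by split=> //; rewrite cB; lia.
  + by move=> v; have := deg v; rewrite mem_enum.
split=> [i j ijA|i iB]; last exact: yB.
by apply: val_inj; exact: yA.
Qed.

End XSpace.

(** * The two maps are smooth and mutually inverse *)

Section Diffeomorphism.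
Context {R : realType} {n k : nat}.
Local Notation C := R[i].
Local Notation "A %:PM" := (map_mx polyC A) (at level 2).
Hypothesis hk : (k <= n./2)%N.
Variables (Gamma : 'End('rV[C]_n)) (E : 'M[C]_n).
Hypothesis hE : jordan_basis k Gamma E.

Let kn : (k <= n)%N. Proof. lia. Qed.
Let Eu : E \in unitmx. Proof. by case: hE. Qed.

(** Applies [springer_Phi] and [springer_step] to the points attached to [V]. The representative [u]
    is left free because both [orth_rep] and the one from [flag_orth] are used later. *)
Lemma springer_orth (V : flag R n) : springer Gamma V ->
  Phi (turns (flag_spheres k E V)) n = diag_powers n k /\
  forall (u : 'M[C]_n) (hu : u *m E \in unitmx), V = row_flag hu -> orth_rows u ->
  forall i : 'I_n, [/\ eval_one k (row i u) != 0,
    pauli (turns (flag_spheres k E V) i) *m eval_one k (row i u) = eval_one k (row i u) &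
    vec_poly k (row i u) = Phi (turns (flag_spheres k E V)) i *m (eval_one k (row i u))%:PM].
Proof.
move=> SV; set x := turns _.
have H (u : 'M[C]_n) (hu : u *m E \in unitmx) : V = row_flag hu -> orth_rows u ->
    let w m := if insub m is Some i then eval_one k (row i u) else 0 in
    Phi x n = diag_powers n k /\
    forall i : 'I_n, spans_line x w i /\ vec_poly k (row i u) = fvec x w i.
  move=> VE ou w; have uu : u \in unitmx.
    by have := hu; rewrite unitmx_mul => /andP[].
  have := SV; rewrite VE => /(springerP hu hE)[L Lt uL].
  have Ls := shift_conj_strict uu Lt uL.
  have wE (i : 'I_n) : w i = eval_one k (row i u) by rewrite /w valK.
  have wx (i : 'I_n) : w i != 0 -> pauli (x i) *m w i = w i.
    rewrite wE => w0.
    suff -> : x i = hopf (eval_one k (row i u)) by exact: hopf_fix.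
    rewrite /x turns_ord /turn /points VE flag_spheresE //.
    by rewrite scalerA -expr2 sqrr_sign scale1r.
  have x1 m : unit_vec (x m) by exact: turns_unit.
  split; first exact: (springer_Phi x1 kn uu ou uL Ls wE wx).
  by move=> i; exact: (springer_step x1 kn uu ou uL Ls wE wx i).
split.
  have [u [hu [VE ou]]] := flag_orth V Eu.
  by have [] := H u hu VE ou.
move=> u hu VE ou i; have [_ /(_ i)[[w0 wx] uE]] := H u hu VE ou.
by move: w0 wx uE; rewrite /fvec valK.
Qed.

Lemma pauli_col_spans_line y i : spans_line (turns y) (pauli_col y (@nonzero_col R n y)) i.
Proof. by split; [exact: nonzero_colP|exact: pauli_col_fix]. Qed.

Lemma spheres_flag_unit y : X_space R n k y ->
  spheres_mx k y (nonzero_col y) *m E \in unitmx.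
Proof.
move=> /(X_spaceP hk) PhiD; rewrite unitmx_mul Eu andbT.
by apply: (fvec_mx_unit (@turns_unit R n y) kn _ PhiD) => i _; exact: pauli_col_spans_line.
Qed.

Lemma spheres_flag_springer y : X_space R n k y ->
  springer Gamma (spheres_flag k E y).
Proof.
move=> Xy; rewrite (spheres_flagE (spheres_flag_unit Xy)).
apply/(springerP _ hE); have PhiD := (X_spaceP hk y).1 Xy.
by apply: (fvec_mx_shift (@turns_unit R n y) kn _ PhiD) => i _; exact: pauli_col_spans_line.
Qed.

(** The rows built from [y] are already orthogonal, and their values at [t = 1] are the chosen
    generators, since every [Phi] is the identity there; [hopf] then recovers the points. *)
Lemma spheres_flagK y : X_space R n k y ->
  flag_spheres k E (spheres_flag k E y) = y.
Proof.
move=> Xy; have PhiD := (X_spaceP hk y).1 Xy.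
have gd i : (i < n)%N -> spans_line (turns y) (pauli_col y (nonzero_col y)) i.
  by move=> _; exact: pauli_col_spans_line.
have x1 := @turns_unit R n y.
have ou : orth_rows (spheres_mx k y (nonzero_col y)).
  by move=> i j; exact: (fvec_mx_orth x1 kn gd PhiD).
rewrite (spheres_flagE (spheres_flag_unit Xy)); apply/ffunP => i; apply: val_inj.
have wE : eval_one k (row i (spheres_mx k y (nonzero_col y))) =
    pauli_col y (nonzero_col y) i.
  by rewrite /eval_one (fvec_mxE x1 kn gd PhiD i) /fvec horner_Phi.
rewrite flag_spheresE // wE; last exact: nonzero_colP.
rewrite (@hopf_unique _ (turns y i)); last exact: pauli_col_fix; last exact: nonzero_colP.
by rewrite turns_ord /turn scalerA -expr2 sqrr_sign scale1r.
Qed.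

(** Each row of an orthogonal representative is [Phi_i] applied to its value at [t = 1]. The chosen
    projector column is a nonzero multiple of that value, so the rebuilt rows are rescaled
    originals. *)
Lemma flag_spheresK V : springer Gamma V ->
  spheres_flag k E (flag_spheres k E V) = V.
Proof.
move=> SV; have [PhiD H] := springer_orth SV.
have [u [hu [VE ou]]] := flag_orth V Eu.
set y := flag_spheres k E V in PhiD H *.
have [|hc hcE] := @spheres_mx_flag R n k E y (nonzero_col y) u hu.
  move=> i; have [w0 wx uE] := H u hu VE ou i.
  have [a aE] := pauli_line (turns_unit y i) w0 wx (delta_mx (nonzero_col y i) 0).
  exists a.
    by apply: contraNneq (nonzero_colP y i) => a0; rewrite /pauli_col aE a0 scale0r.
  apply: (etrans (spheres_mx_row k y (nonzero_col y) i)).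
  rewrite -[row i u](vec_polyK kn) uE.
  exact: (@poly_vec_fvecZ R n k (turns y) (pauli_col y (nonzero_col y))
    (fun=> eval_one k (row i u)) a i aE).
by rewrite (spheres_flagE hc) hcE VE.
Qed.

Lemma springer_diffeomorphic :
  diffeomorphic (flag_atlas R n) (spheres_atlas R n) (springer Gamma) (X_space R n k).
Proof.
exists (flag_spheres k E), (spheres_flag k E); split.
- split=> [V SV|y Xy]; last exact: spheres_flag_springer.
  by apply/(X_spaceP hk); have [] := springer_orth SV.
- exact: flag_spheresK.
- exact: spheres_flagK.
- move=> V SV; exists (flag_domain k E), (flag_spheres k E); split=> //.
  + exact: flag_domain_open.
  + have [hu [VE ou]] := orth_repP Eu V.
    by move=> i; have [_ /(_ _ hu VE ou i)[]] := springer_orth SV.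
  + exact: flag_spheres_smooth.
(* The columns are frozen at their choice for this [y], which gives an open neighbourhood with a
   rational lift. *)
- move=> y Xy; exists (spheres_domain k E (nonzero_col y)), (spheres_flag k E); split=> //.
  + exact: spheres_domain_open.
  + exact: spheres_flag_unit.
  + exact: spheres_flag_smooth.
Qed.

End Diffeomorphism.

Theorem theorem2p6 (R : realType) (n k : nat) (hn : (1 <= n)%N)
    (hk : (k <= n./2)%N) (Gamma : 'End('rV[R[i]]_n))
    (hGamma : nilpotent_two_blocks k Gamma) :
  diffeomorphic (flag_atlas R n) (spheres_atlas R n)
    (springer Gamma) (X_space R n k).
Proof.
have [E hE] := jordan_basis_ex hGamma.
exact: (springer_diffeomorphic hk hE).
Qed.
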